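(* Let $m\ge 0$, and for $a,\epsilon>0$ let $(X,g)=(X_{a,\epsilon},g_{a,\epsilon})$ be the multi-Eguchi--Hanson ($m=0$) or multi-Taub--NUT ($m>0$) space whose singular points of $\phi$ are $p_1=(0,0,a)$, $p_2=(0,0,-a)$ and $p_3=(0,\epsilon,0)$. Let $N=\pi^{-1}([p_1,p_2])$ be the $S^1$-invariant compact minimal surface over the segment joining $p_1$ and $p_2$. Then: (i) for every fixed $a>0$ there exists a sufficiently small $\epsilon>0$ such that the operator $-\mathcal{R}-\mathcal{A}$ of $N$ is negative at the points of $\pi^{-1}(0)$; (ii) for every fixed $\epsilon>0$ there exists a sufficiently large $a>0$ such that the operator $-\mathcal{R}-\mathcal{A}$ of $N$ is negative at the points of $\pi^{-1}(0)$.
   Context: Multi-Eguchi--Hanson and multi-Taub--NUT spaces: let $p_1,\dots,p_k$ be distinct points of $\mathbb{R}^3$ ($k\ge 1$), let $m\ge 0$, let $U=\mathbb{R}^3\setminus\{p_1,\dots,p_k\}$, and let $\phi(x)=m+\sum_{i=1}^k \frac{1}{2|x-p_i|}$ on $U$. Let $\pi:X_0\to U$ be the principal $S^1$-bundle (with $S^1=\mathbb{R}/2\pi\mathbb{Z}$) carrying a connection $1$-form $\eta$ (that is, $\eta$ is $S^1$-invariant and $\eta(\xi)=1$, with $\xi$ the infinitesimal generator of the action) such that $d\eta=\pi^*( *_{\mathbb{R}^3}d\phi)$, and put $g=\phi^{-1}\eta^2+\phi\,\pi^*g_{\mathbb{R}^3}$. Adding one point over each $p_i$ yields a smooth complete hyperkähler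 $4$-manifold $(X,g)$ to which the $S^1$-action extends (fixing the added points), and $\pi$ extends to $\pi:X\to\mathbb{R}^3$. It is called a multi-Eguchi--Hanson space if $m=0$ and a multi-Taub--NUT space if $m>0$; the $p_i$ are called the singular points of $\phi$. For a minimal submanifold $\Sigma$ with second fundamental form $A(X,Y)=(\nabla_XY)^\perp$ and local orthonormal tangent frame $\{e_i\}$, $\mathcal{R},\mathcal{A}$ are the symmetric operators on the normal bundle with $\langle\mathcal{R}(V),V\rangle=\sum_i\langle R(e_i,V)V,e_i\rangle$ (a sum of sectional curvatures when $|V|=1$) and $\mathcal{A}(V)=\sum_{i,j}\langle A(e_i,e_j),V\rangle A(e_i,e_j)$. Negative at a point means negative definite on the normal space at that point. *)

(* Defs.v *)
From HB Require Import structures.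
From mathcomp Require Import all_boot all_order all_algebra.
From mathcomp Require Import all_classical all_reals all_analysis.

Set Implicit Arguments.
Unset Strict Implicit.
Unset Printing Implicit Defensive.

Import Order.TTheory GRing.Theory Num.Theory.
Import numFieldNormedType.Exports.

Local Open Scope classical_set_scope.
Local Open Scope ring_scope.

Section Smooth.
Variable R : realType.

Definition basis_vec (n : nat) (i : 'I_n) : 'rV[R]_n := delta_mx 0 i.

Definition dotv (n : nat) (v w : 'rV[R]_n) : R := \sum_i v 0 i * w 0 i.

(* The norm of the normed space 'rV[R]_n is the sup norm. *)
Definition eucl_norm (n : nat) (v : 'rV[R]_n) : R := Num.sqrt (dotv v v).

Definition pd (n : nat) (i : 'I_n.+1) (f : 'rV[R]_n.+1 -> R) (x : 'rV[R]_n.+1) : R :=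
  'D_(basis_vec i) f x.

Fixpoint Ck_on (n k : nat) (W : set 'rV[R]_n.+1) (f : 'rV[R]_n.+1 -> R) : Prop :=
  (forall x, W x -> {for x, continuous f}) /\
  (if k is k'.+1 then
     forall i, (forall x, W x -> derivable f x (basis_vec i)) /\ Ck_on k' W (pd i f)
   else True).

(* To be used with W open. *)
Definition smooth_on (n : nat) (W : set 'rV[R]_n.+1) (f : 'rV[R]_n.+1 -> R) : Prop :=
  forall k, Ck_on k W f.

Definition smooth_vec_on (n l : nat) (W : set 'rV[R]_n.+1)
    (F : 'rV[R]_n.+1 -> 'rV[R]_l) : Prop :=
  forall i, smooth_on W (fun x => F x 0 i).

Definition pd_vec (n l : nat) (a : 'I_n.+1) (F : 'rV[R]_n.+1 -> 'rV[R]_l)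
    (x : 'rV[R]_n.+1) : 'rV[R]_l :=
  \row_i pd a (fun y => F y 0 i) x.

(* Row a is the a-th partial derivative, so vectors are pushed forward by
   v |-> v *m jac F x. *)
Definition jac (n l : nat) (F : 'rV[R]_n.+1 -> 'rV[R]_l) (x : 'rV[R]_n.+1) :
    'M[R]_(n.+1, l) :=
  \matrix_(a < n.+1) pd_vec a F x.

End Smooth.

Section RiemannianCoordinates.
Variables (R : realType) (n : nat).
(* A Riemannian metric in local coordinates. *)
Variable G : 'rV[R]_n.+1 -> 'M[R]_n.+1.

Definition ip (x v w : 'rV[R]_n.+1) : R := (v *m G x *m w^T) 0 0.

(* Gamma^k_ij *)
Definition christoffel (k i j : 'I_n.+1) (x : 'rV[R]_n.+1) : R :=
  2^-1 * \sum_l invmx (G x) k l *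
    (pd i (fun y => G y j l) x + pd j (fun y => G y i l) x
     - pd l (fun y => G y i j) x).

(* The l-th component of R(d_i, d_j) d_k, for the convention
   R(X,Y)Z = nabla_X nabla_Y Z - nabla_Y nabla_X Z - nabla_[X,Y] Z. *)
Definition riemann (l k i j : 'I_n.+1) (x : 'rV[R]_n.+1) : R :=
  pd i (christoffel l j k) x - pd j (christoffel l i k) x
  + \sum_p (christoffel l i p x * christoffel p j k x
            - christoffel l j p x * christoffel p i k x).

Definition curv (x X Y Z : 'rV[R]_n.+1) : 'rV[R]_n.+1 :=
  \row_l \sum_i \sum_j \sum_k riemann l k i j x * X 0 i * Y 0 j * Z 0 k.

Section Submanifold.
(* A parametrised submanifold of dimension d.+1, studied at F w. *)
Variables (d : nat) (F : 'rV[R]_d.+1 -> 'rV[R]_n.+1) (w : 'rV[R]_d.+1).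

Definition tangent (a : 'I_d.+1) : 'rV[R]_n.+1 := pd_vec a F w.

Definition first_form : 'M[R]_d.+1 :=
  \matrix_(a, b) ip (F w) (tangent a) (tangent b).

Definition is_normal (V : 'rV[R]_n.+1) : Prop :=
  forall a, ip (F w) V (tangent a) = 0.

Definition normal_part (V : 'rV[R]_n.+1) : 'rV[R]_n.+1 :=
  V - \sum_a \sum_b (invmx first_form a b * ip (F w) V (tangent a)) *: tangent b.

(* The ambient covariant derivative of the tangent field d_b F along d_a F. *)
Definition cov_deriv (a b : 'I_d.+1) : 'rV[R]_n.+1 :=
  \row_k (pd a (pd b (fun y => F y 0 k)) w
          + \sum_i \sum_j christoffel k i j (F w) * tangent a 0 i * tangent b 0 j).

(* Tangent vectors of the submanifold are given by their components in the
   coordinate frame d_a F. *)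
Definition push (X : 'rV[R]_d.+1) : 'rV[R]_n.+1 := \sum_a X 0 a *: tangent a.

Definition second_form (X Y : 'rV[R]_d.+1) : 'rV[R]_n.+1 :=
  normal_part (\sum_a \sum_b (X 0 a * Y 0 b) *: cov_deriv a b).

Definition orthonormal_frame (e : 'I_d.+1 -> 'rV[R]_d.+1) : Prop :=
  forall i j, ip (F w) (push (e i)) (push (e j)) = (i == j)%:R.

(* <R(V), V> *)
Definition normal_curv_form (e : 'I_d.+1 -> 'rV[R]_d.+1) (V : 'rV[R]_n.+1) : R :=
  \sum_i ip (F w) (curv (F w) (push (e i)) V V) (push (e i)).

(* The operator V |-> sum_ij <A(e_i,e_j), V> A(e_i,e_j). *)
Definition simons_op (e : 'I_d.+1 -> 'rV[R]_d.+1) (V : 'rV[R]_n.+1) : 'rV[R]_n.+1 :=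
  \sum_i \sum_j ip (F w) (second_form (e i) (e j)) V *: second_form (e i) (e j).

(* -R - A is negative definite on the normal space at F w.  Both operators are
   independent of the orthonormal frame. *)
Definition negative_stability_op : Prop :=
  forall e, orthonormal_frame e ->
  forall V, is_normal V -> V != 0 ->
    - normal_curv_form e V - ip (F w) (simons_op e V) V < 0.

End Submanifold.
End RiemannianCoordinates.

Section GibbonsHawking.
Variable R : realType.

(* Coordinates (t, x) on open subsets of R x R^3: index 0 is the fibre
   coordinate t, indices 1, 2, 3 are x. *)
Definition base_pt (u : 'rV[R]_4) : 'rV[R]_3 := \row_(i < 3) u 0 (lift ord0 i).

Definition bundle_coord (t : R) (x : 'rV[R]_3) : 'rV[R]_4 :=
  \row_(i < 4) if unlift ord0 i is Some j then x 0 j else t.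

(* Generator of the circle action in these coordinates. *)
Definition fibre_vec : 'rV[R]_4 := basis_vec R (ord0 : 'I_4).

Definition point3 (x y z : R) : 'rV[R]_3 := \row_(i < 3) [:: x; y; z]`_i.

Definition cross_prod (v w : 'rV[R]_3) : 'rV[R]_3 :=
  let c (u : 'rV[R]_3) (i : nat) := u 0 (inord i) in
  point3 (c v 1%N * c w 2%N - c v 2%N * c w 1%N)
         (c v 2%N * c w 0%N - c v 0%N * c w 2%N)
         (c v 0%N * c w 1%N - c v 1%N * c w 0%N).

Definition gradient (f : 'rV[R]_3 -> R) (x : 'rV[R]_3) : 'rV[R]_3 :=
  \row_i pd i f x.

(* The Hodge dual of df: star(alpha)(v, w) = alpha(v x w) on R^3 with its
   standard metric and orientation. *)
Definition star_d (f : 'rV[R]_3 -> R) (x v w : 'rV[R]_3) : R :=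
  dotv (gradient f x) (cross_prod v w).

(* Exterior derivative of the 1-form with components eta; v and w are extended
   as constant vector fields. *)
Definition ext_d (eta : 'rV[R]_4 -> 'rV[R]_4) (u v w : 'rV[R]_4) : R :=
  'D_v (fun y => dotv (eta y) w) u - 'D_w (fun y => dotv (eta y) v) u.

Section Potential.
Variables (m : R) (k : nat) (p : 'I_k -> 'rV[R]_3).

Definition regular_set : set 'rV[R]_3 := [set x | forall i, x != p i].

Definition gh_potential (x : 'rV[R]_3) : R :=
  m + \sum_i (2 * eucl_norm (x - p i))^-1.

(* phi^-1 eta^2 + phi pi^* g_{R^3} *)
Definition gh_metric (eta : 'rV[R]_4 -> 'rV[R]_4) (u : 'rV[R]_4) : 'M[R]_4 :=
  let phi := gh_potential (base_pt u) in
  \matrix_(i, j) (phi^-1 * (eta u 0 i * eta u 0 j)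
    + phi * dotv (base_pt (basis_vec R i)) (base_pt (basis_vec R j))).

(* The space X with its circle action and projection to R^3.  The circle
   R/2piZ acts through R.  The smooth structure on X_0 = gh_proj^-1(regular_set)
   is the one of a principal bundle: it is given by an atlas of local
   trivialisations, each lifted to a parametrisation (t, x) |-> triv_par c (t, x)
   of gh_proj^-1(triv_dom c) by R x triv_dom c.  The connection form is given by
   its components triv_conn in these coordinates.  Around each added point a cap
   chart gives the extension of the smooth structure and of the metric. *)
Record gh_space := GHSpace {
  pt :> Type;
  gh_proj : pt -> 'rV[R]_3;
  gh_act : R -> pt -> pt;
  triv : Type;
  triv_dom : triv -> set 'rV[R]_3;
  triv_par : triv -> 'rV[R]_4 -> pt;
  triv_conn : triv -> 'rV[R]_4 -> 'rV[R]_4;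
  cap_dom : 'I_k -> set 'rV[R]_4;
  cap_par : 'I_k -> 'rV[R]_4 -> pt;
  cap_metric : 'I_k -> 'rV[R]_4 -> 'M[R]_4;

  act0 : forall x, gh_act 0 x = x;
  actD : forall s t x, gh_act (s + t) x = gh_act s (gh_act t x);
  act_period : forall x, gh_act (2 * pi) x = x;
  proj_act : forall s x, gh_proj (gh_act s x) = gh_proj x;
  act_free : forall s x, regular_set (gh_proj x) -> gh_act s x = x ->
    exists z : int, s = z%:~R * (2 * pi);
  act_trans : forall x y, regular_set (gh_proj x) -> gh_proj x = gh_proj y ->
    exists s, y = gh_act s x;
  one_point_over : forall i, exists! x, gh_proj x = p i;

  triv_open : forall c, open (triv_dom c);
  triv_regular : forall c, triv_dom c `<=` regular_set;
  triv_cover : forall x, regular_set x -> exists c, triv_dom c x;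
  proj_triv : forall c u, triv_dom c (base_pt u) ->
    gh_proj (triv_par c u) = base_pt u;
  act_triv : forall c u s, triv_dom c (base_pt u) ->
    gh_act s (triv_par c u) = triv_par c (u + s *: fibre_vec);

  conn_smooth : forall c,
    smooth_vec_on [set u | triv_dom c (base_pt u)] (triv_conn c);
  conn_invariant : forall c u s, triv_dom c (base_pt u) ->
    triv_conn c (u + s *: fibre_vec) = triv_conn c u;
  conn_fibre : forall c u, triv_dom c (base_pt u) ->
    dotv (triv_conn c u) fibre_vec = 1;
  conn_curvature : forall c u v w, triv_dom c (base_pt u) ->
    ext_d (triv_conn c) u v w =
      star_d gh_potential (base_pt u) (base_pt v) (base_pt w);

  (* Transition functions (t, x) |-> (t + tau x, x), under which the local
     expressions of the connection form correspond. *)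
  triv_transition : forall c d x, triv_dom c x -> triv_dom d x ->
    exists (W : set 'rV[R]_3) (tau : 'rV[R]_3 -> R),
      [/\ open W, W x, W `<=` triv_dom c `&` triv_dom d, smooth_on W tau &
          forall t y, W y ->
            triv_par d (bundle_coord t y) =
              triv_par c (bundle_coord (t + tau y) y) /\
            forall v, dotv (triv_conn d (bundle_coord t y)) v =
              dotv (triv_conn c (bundle_coord (t + tau y) y))
                  (v + 'D_(base_pt v) tau y *: fibre_vec)];

  cap_open : forall i, open (cap_dom i);
  cap_inj : forall i u v, cap_dom i u -> cap_dom i v ->
    cap_par i u = cap_par i v -> u = v;
  cap_nbhs : forall i, exists B : set 'rV[R]_3,
    [/\ open B, B (p i) &
        forall x, B (gh_proj x) -> exists2 u, cap_dom i u & cap_par i u = x];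
  cap_proj_smooth : forall i,
    smooth_vec_on (cap_dom i) (fun u => gh_proj (cap_par i u));
  cap_metric_smooth : forall i a b,
    smooth_on (cap_dom i) (fun u => cap_metric i u a b);
  cap_metric_sym : forall i u, cap_dom i u ->
    (cap_metric i u)^T = cap_metric i u;
  cap_metric_pos : forall i u v, cap_dom i u -> v != 0 ->
    0 < ip (cap_metric i) u v v;
  cap_transition : forall i c v u, cap_dom i v -> triv_dom c (base_pt u) ->
    cap_par i v = triv_par c u ->
    exists (W : set 'rV[R]_4) (T : 'rV[R]_4 -> 'rV[R]_4),
      [/\ open W, W u, smooth_vec_on W T, T u = v &
          forall y, W y ->
            [/\ triv_dom c (base_pt y), cap_dom i (T y),
                cap_par i (T y) = triv_par c y &
                gh_metric (triv_conn c) y =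
                  jac T y *m cap_metric i (T y) *m (jac T y)^T]]
}.

End Potential.

(* F is a regular parametrisation, near w, of a surface lying in N, read in
   the trivialisation c. *)
Definition local_param (m : R) (k : nat) (p : 'I_k -> 'rV[R]_3)
    (X : gh_space m p) (N : set X) (c : triv X)
    (F : 'rV[R]_2 -> 'rV[R]_4) (w : 'rV[R]_2) : Prop :=
  exists W : set 'rV[R]_2,
    [/\ open W, W w, smooth_vec_on W F &
        forall y, W y ->
          [/\ triv_dom c (base_pt (F y)), N (triv_par c (F y)) &
              row_free (jac F y)]].

(* N is, near x in X_0, a surface whose operator -R - A is negative at x.  The
   first conjunct excludes points where no parametrisation exists. *)
Definition negative_at (m : R) (k : nat) (p : 'I_k -> 'rV[R]_3)
    (X : gh_space m p) (N : set X) (x : X) : Prop :=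
  let at_x (c : triv X) F w := local_param N c F w /\ triv_par c (F w) = x in
  (exists c F w, at_x c F w) /\
  (forall c F w, at_x c F w ->
    negative_stability_op (gh_metric m p (triv_conn c)) F w).

Definition line_segment (x y : 'rV[R]_3) : set 'rV[R]_3 :=
  [set (1 - s) *: x + s *: y | s in [set s : R | 0 <= s <= 1]].

Definition surface_over (m : R) (k : nat) (p : 'I_k -> 'rV[R]_3)
    (X : gh_space m p) (x y : 'rV[R]_3) : set X :=
  [set z | line_segment x y (gh_proj z)].

Definition three_points (a e : R) (i : 'I_3) : 'rV[R]_3 :=
  [:: point3 0 0 a; point3 0 0 (- a); point3 0 e 0]`_i.

End GibbonsHawking.

Arguments surface_over {R m k p} X x y.

(* Main.v *)
Require Import Defs.
From mathcomp Require Import all_boot all_order all_algebra.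
From mathcomp Require Import all_classical all_reals all_analysis.
From mathcomp Require Import ring lra.

(* Let xi generate the circle action and let h_1, h_2, h_3 be the horizontal
   lifts of the coordinate fields at a point over the x_3-axis where d_1 phi and
   d_3 phi vanish.  The tangent plane of N is spanned by xi and h_3; write a
   normal vector as V = v_1 h_1 + v_2 h_2, so that |V|^2 = phi |v|^2.  The
   Koszul formula gives
     phi <R(xi, V)V, xi> + phi^-1 <R(h_3, V)V, h_3>
       = - d_33 phi |v|^2 / (2 phi) - |d phi|^2 |v|^2 / (2 phi^2),
   while the second fundamental form contributes |d phi|^2 |v|^2 / (2 phi^2).
   Hence -R-A is multiplication by d_33 phi / (2 phi^2), the Gauss curvature of
   N.  For the three given points d_33 phi (0) = 2 / a^3 - 1 / (2 e^3), which is
   negative as soon as 2 e < a. *)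

Set Implicit Arguments.
Unset Strict Implicit.
Unset Printing Implicit Defensive.

Import Order.TTheory GRing.Theory Num.Theory.
Import numFieldNormedType.Exports.

Local Open Scope classical_set_scope.
Local Open Scope ring_scope.

(** * Directional derivatives assembled from partial derivatives *)

Section DirectionalDerivative.
Variables (R : realType) (n : nat).
Implicit Types (f g : 'rV[R]_n.+1 -> R) (x Y Z : 'rV[R]_n.+1).

(** The statement is phrased in raw coordinates: Christoffel symbols through an inverse matrix,
    arbitrary parametrisations of N, arbitrary orthonormal frames, and a connection form eta known
    only through its axioms. So every covariant quantity is paired with a vector and expanded on
    constant coordinate fields: their brackets vanish, and Koszul's formula then contains only
    derivatives of metric coefficients. The price is that a constant field equal to h_i at x is
    horizontal at x only. First derivatives of eta therefore enter; their antisymmetric part is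
    dictated by d eta = star d phi, whereas the symmetric part depends on the trivialisation and
    must cancel.

    Were all singular points on the axis, d phi would be tangent to it and N would be totally
    geodesic over regular points. The point p_3 gives d_2 phi(0) = 1 / (2 e^2), which is why both
    the curvature and A carry terms in |d phi|^2.

    The frame of N enters only through three sums of products of its coefficients, and
    orthonormality determines all three. *)

Definition pdable f x : Prop := forall a, derivable f x (basis_vec R a).

(** Taking a combination of partial derivatives, instead of the derivative along Y, makes linearity
    in Y hold by construction, with no appeal to total differentiability. *)
Definition dird Y f x : R := \sum_a Y 0 a * pd a f x.

Lemma pdable_cst c x : pdable (fun=> c) x.
Proof. by move=> a; exact: derivable_cst. Qed.

Lemma pdableD f g x : pdable f x -> pdable g x ->
  pdable (fun y => f y + g y) x.
Proof. by move=> df dg a; exact: derivableD. Qed.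

Lemma pdableN f x : pdable f x -> pdable (fun y => - f y) x.
Proof. by move=> df a; exact: derivableN. Qed.

Lemma pdableM f g x : pdable f x -> pdable g x ->
  pdable (fun y => f y * g y) x.
Proof. by move=> df dg a; exact: derivableM. Qed.

Lemma pdableV f x : f x != 0 -> pdable f x -> pdable (fun y => (f y)^-1) x.
Proof. by move=> fx df a; exact: derivableV. Qed.

Lemma pdableZ c f x : pdable f x -> pdable (fun y => c * f y) x.
Proof.
move=> df; have dc : pdable (fun=> c) x by exact: pdable_cst.
exact: (pdableM dc df).
Qed.

Lemma pdable_sum k (h : 'I_k -> 'rV[R]_n.+1 -> R) x :
  (forall i, pdable (h i) x) -> pdable (fun y => \sum_i h i y) x.
Proof.
move=> dh a; have -> : (fun y => \sum_i h i y) = \sum_i h i.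
  by apply/funext => y; rewrite fct_sumE.
by apply: derivable_sum => i; exact: dh.
Qed.

Lemma pdable_near f g x : (\forall y \near x, f y = g y) ->
  pdable f x -> pdable g x.
Proof. by move=> fg df a; exact: near_eq_derivable (df a). Qed.

Lemma pdable_dird Y f x : (forall a, pdable (pd a f) x) -> pdable (dird Y f) x.
Proof. by move=> df; apply: pdable_sum => a; exact: pdableZ. Qed.

Lemma pd_near a f g x : (\forall y \near x, f y = g y) -> pd a f x = pd a g x.
Proof. by move=> fg; exact: near_eq_derive. Qed.

Lemma pd_cst a c x : pd a (fun=> c) x = 0.
Proof. exact: derive_cst. Qed.

Lemma pdD a f g x : pdable f x -> pdable g x ->
  pd a (fun y => f y + g y) x = pd a f x + pd a g x.
Proof. by move=> df dg; exact: deriveD. Qed.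

Lemma pdM a f g x : pdable f x -> pdable g x ->
  pd a (fun y => f y * g y) x = f x * pd a g x + g x * pd a f x.
Proof. by move=> df dg; exact: deriveM. Qed.

Lemma pdV a f x : f x != 0 -> pdable f x ->
  pd a (fun y => (f y)^-1) x = - (f x ^- 2) * pd a f x.
Proof. by move=> fx df; exact: deriveV. Qed.

Lemma pd_sum a k (h : 'I_k -> 'rV[R]_n.+1 -> R) x :
  (forall i, pdable (h i) x) ->
  pd a (fun y => \sum_i h i y) x = \sum_i pd a (h i) x.
Proof.
move=> dh; have -> : (fun y => \sum_i h i y) = \sum_i h i.
  by apply/funext => y; rewrite fct_sumE.
by apply: derive_sum => i; exact: dh.
Qed.

Lemma dird_near Y f g x : (\forall y \near x, f y = g y) ->
  dird Y f x = dird Y g x.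
Proof. by move=> fg; apply: eq_bigr => a _; rewrite (pd_near a fg). Qed.

Lemma dird_cst Y c x : dird Y (fun=> c) x = 0.
Proof. by apply: big1 => a _; rewrite pd_cst mulr0. Qed.

Lemma dirdD Y f g x : pdable f x -> pdable g x ->
  dird Y (fun y => f y + g y) x = dird Y f x + dird Y g x.
Proof.
move=> df dg; rewrite -big_split /=; apply: eq_bigr => a _.
by rewrite pdD// mulrDr.
Qed.

Lemma dirdM Y f g x : pdable f x -> pdable g x ->
  dird Y (fun y => f y * g y) x = f x * dird Y g x + g x * dird Y f x.
Proof.
move=> df dg; rewrite !mulr_sumr -big_split /=; apply: eq_bigr => a _.
by rewrite pdM//; ring.
Qed.

Lemma dirdZ Y c f x : pdable f x ->
  dird Y (fun y => c * f y) x = c * dird Y f x.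
Proof.
move=> df; have dc : pdable (fun=> c) x by exact: pdable_cst.
by rewrite (dirdM _ dc df) dird_cst mulr0 addr0.
Qed.

Lemma dirdN Y f x : pdable f x -> dird Y (fun y => - f y) x = - dird Y f x.
Proof.
move=> df; rewrite -mulN1r -dirdZ//; apply: dird_near.
by near=> y; rewrite mulN1r.
Unshelve. all: by end_near. Qed.

Lemma dirdV Y f x : f x != 0 -> pdable f x ->
  dird Y (fun y => (f y)^-1) x = - (f x ^- 2) * dird Y f x.
Proof.
move=> fx df; rewrite mulr_sumr; apply: eq_bigr => a _.
by rewrite pdV//; ring.
Qed.

Lemma dird_sum Y k (h : 'I_k -> 'rV[R]_n.+1 -> R) x :
  (forall i, pdable (h i) x) ->
  dird Y (fun y => \sum_i h i y) x = \sum_i dird Y (h i) x.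
Proof.
move=> dh; rewrite /dird exchange_big; apply: eq_bigr => a _ /=.
by rewrite pd_sum// mulr_sumr.
Qed.

Lemma dirdDl Y Z f x : dird (Y + Z) f x = dird Y f x + dird Z f x.
Proof.
by rewrite -big_split; apply: eq_bigr => a _ /=; rewrite mxE mulrDl.
Qed.

Lemma dirdZl c Y f x : dird (c *: Y) f x = c * dird Y f x.
Proof. by rewrite mulr_sumr; apply: eq_bigr => a _; rewrite mxE mulrA. Qed.

Lemma dird_basis a f x : dird (basis_vec R a) f x = pd a f x.
Proof.
rewrite /dird (bigD1 a)//= big1 ?addr0 => [|b ba]; rewrite mxE eqxx /=.
  by rewrite eqxx mul1r.
by rewrite (negPf ba) mul0r.
Qed.

End DirectionalDerivative.

(** * Koszul's formula and the curvature tensor in coordinates *)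

Section MetricDerivatives.
Variables (R : realType) (n : nat) (G : 'rV[R]_n.+1 -> 'M[R]_n.+1).
Implicit Types (x u X Y Z W : 'rV[R]_n.+1).

Lemma ipE x v w : ip G x v w = \sum_i \sum_j v 0 i * G x i j * w 0 j.
Proof.
rewrite /ip mxE exchange_big; apply: eq_bigr => j _ /=.
by rewrite mxE mulr_suml; apply: eq_bigr => i _; rewrite mxE.
Qed.

Lemma ipDl x v v' w : ip G x (v + v') w = ip G x v w + ip G x v' w.
Proof. by rewrite /ip !mulmxDl mxE. Qed.

Lemma ipDr x v w w' : ip G x v (w + w') = ip G x v w + ip G x v w'.
Proof. by rewrite /ip linearD mulmxDr mxE. Qed.

Lemma ipZl x c v w : ip G x (c *: v) w = c * ip G x v w.
Proof. by rewrite /ip -!scalemxAl mxE. Qed.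

Lemma ipZr x c v w : ip G x v (c *: w) = c * ip G x v w.
Proof. by rewrite /ip linearZ -scalemxAr mxE. Qed.

Lemma ipNl x v w : ip G x (- v) w = - ip G x v w.
Proof. by rewrite -scaleN1r ipZl mulN1r. Qed.

Lemma ip_suml x k (v : 'I_k -> 'rV[R]_n.+1) w :
  ip G x (\sum_i v i) w = \sum_i ip G x (v i) w.
Proof. by rewrite /ip !mulmx_suml summxE. Qed.

Lemma ipC x v w : (G x)^T = G x -> ip G x v w = ip G x w v.
Proof.
move=> sG; rewrite /ip; set M := _ *m w^T; rewrite -[in LHS](trmxK M) mxE /M.
by rewrite !trmx_mul trmxK sG mulmxA.
Qed.

(** This is nabla_X Y for constant fields: the components of Y have zero derivative, so only the
    Christoffel term remains. *)
Definition connv X Y u : 'rV[R]_n.+1 :=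
  \row_k \sum_i \sum_j christoffel G k i j u * X 0 i * Y 0 j.

(* <nabla_X Y, Z> for constant vector fields X, Y and Z. *)
Definition koszul X Y Z u : R :=
  2^-1 * (dird X (fun y => ip G y Y Z) u + dird Y (fun y => ip G y X Z) u
          - dird Z (fun y => ip G y X Y) u).

Definition metric_pdable x := forall i j, pdable (fun y => G y i j) x.

Lemma pd_ip a Y Z x : metric_pdable x ->
  pd a (fun y => ip G y Y Z) x =
  \sum_i \sum_j Y 0 i * Z 0 j * pd a (fun y => G y i j) x.
Proof.
move=> dG; under [X in pd a X]eq_fun do rewrite ipE.
have dt i j : pdable (fun y => Y 0 i * G y i j * Z 0 j) x.
  by under eq_fun do rewrite mulrAC; exact: pdableZ.
rewrite pd_sum => [|i]; last by apply: pdable_sum.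
apply: eq_bigr => i _; rewrite pd_sum//; apply: eq_bigr => j _.
rewrite -dird_basis.
under [X in dird _ X]eq_fun do rewrite mulrAC.
by rewrite dirdZ// dird_basis.
Qed.

Lemma dird_ip X Y Z x : metric_pdable x ->
  dird X (fun y => ip G y Y Z) x =
  \sum_a \sum_i \sum_j X 0 a * Y 0 i * Z 0 j * pd a (fun y => G y i j) x.
Proof.
move=> dG; apply: eq_bigr => a _; rewrite pd_ip// mulr_sumr.
apply: eq_bigr => i _; rewrite mulr_sumr; apply: eq_bigr => j _.
by rewrite !mulrA.
Qed.

(** Lowering the index multiplies by the metric and cancels the inverse matrix in the Christoffel
    symbols. All later computations go through this form and never meet [invmx]. *)
Lemma ip_connv X Y Z u : metric_pdable u -> (G u)^T = G u -> G u \in unitmx ->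
  ip G u (connv X Y u) Z = koszul X Y Z u.
Proof.
move=> dG sG uG.
(* [T] is twice the Christoffel symbol of the first kind, contracted with X and Y. *)
pose T : 'rV[R]_n.+1 := \row_l \sum_i \sum_j X 0 i * Y 0 j *
  (pd i (fun y => G y j l) u + pd j (fun y => G y i l) u
     - pd l (fun y => G y i j) u).
have -> : connv X Y u = 2^-1 *: (T *m (invmx (G u))^T).
  apply/rowP => k; rewrite !mxE mulr_sumr; under [RHS]eq_bigr => l _.
    rewrite !mxE mulr_suml mulr_sumr.
    under eq_bigr do rewrite mulr_suml mulr_sumr.
    over.
  rewrite [RHS]exchange_big; apply: eq_bigr => i _ /=.
  rewrite [RHS]exchange_big; apply: eq_bigr => j _ /=.
  rewrite /christoffel mulr_sumr !mulr_suml; apply: eq_bigr => l _.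
  by ring.
rewrite ipZl /ip -mulmxA -{2}sG mulmxA -(mulmxA T) -trmx_mul mulmxV//.
rewrite trmx1 mulmx1 /koszul !dird_ip//; congr (_ * _).
have -> : (T *m Z^T) 0 0 = \sum_i \sum_j \sum_l X 0 i * Y 0 j *
    (pd i (fun y => G y j l) u + pd j (fun y => G y i l) u
     - pd l (fun y => G y i j) u) * Z 0 l.
  rewrite mxE; under eq_bigr do rewrite !mxE mulr_suml.
  rewrite exchange_big; apply: eq_bigr => i _ /=.
  under eq_bigr do rewrite mulr_suml.
  by rewrite exchange_big.
rewrite [X in X - _]addrC [in RHS]exchange_big /=.
have -> :
  \sum_a \sum_i \sum_j Z 0 a * X 0 i * Y 0 j * pd a (fun y => G y i j) u =
  \sum_i \sum_j \sum_a Z 0 a * X 0 i * Y 0 j * pd a (fun y => G y i j) u.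
  by rewrite exchange_big; apply: eq_bigr => i _; rewrite exchange_big.
rewrite -big_split -sumrB; apply: eq_bigr => i _ /=.
rewrite -big_split -sumrB; apply: eq_bigr => j _ /=.
rewrite -big_split -sumrB; apply: eq_bigr => l _ /=.
by ring.
Qed.

(** Compatibility of the connection with the metric. Symmetry is required near u because inner
    products are swapped under a derivative. *)
Lemma dird_ip_koszul X Y Z u : metric_pdable u ->
  (\forall y \near u, (G y)^T = G y) ->
  dird X (fun y => ip G y Y Z) u = koszul X Y Z u + koszul X Z Y u.
Proof.
move=> dG sG; rewrite /koszul.
have sw P Q S : dird S (fun y => ip G y P Q) u = dird S (fun y => ip G y Q P) u.
  by apply: dird_near; near=> y; apply: ipC; near: y.
rewrite (sw Z Y) (sw X Z) (sw X Y).
by do 3!move: (dird _ _ _) => ?; field.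
Unshelve. all: by end_near. Qed.

(** The bracket of constant fields is zero, so R(X,Y)Z is a commutator of two covariant derivatives.
    The inner field nabla_Y Z is no longer constant: its derivative along X is the componentwise
    derivative plus [connv] of its value at x. *)
Lemma curvE x X Y Z : (forall k i j, pdable (christoffel G k i j) x) ->
  curv G x X Y Z =
  \row_l (dird X (fun u => connv Y Z u 0 l) x)
  - \row_l (dird Y (fun u => connv X Z u 0 l) x)
  + connv X (connv Y Z x) x - connv Y (connv X Z x) x.
Proof.
move=> dC.
have dc P Q S l : dird P (fun u => connv Q S u 0 l) x =
    \sum_i \sum_j \sum_k pd i (christoffel G l j k) x * P 0 i * Q 0 j * S 0 k.
  apply: eq_bigr => a _.
  have dt i j : pdable (fun y => christoffel G l i j y * Q 0 i * S 0 j) x.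
    apply: pdableM; last exact: pdable_cst.
    by apply: pdableM => //; exact: pdable_cst.
  rewrite (_ : (fun u => connv Q S u 0 l) = fun u =>
    \sum_i \sum_j christoffel G l i j u * Q 0 i * S 0 j); last first.
    by apply/funext => u; rewrite mxE.
  rewrite pd_sum => [|i]; last by apply: pdable_sum.
  rewrite mulr_sumr; apply: eq_bigr => i _.
  rewrite pd_sum// mulr_sumr; apply: eq_bigr => j _.
  under [X in pd _ X]eq_fun do rewrite -mulrA mulrC.
  rewrite -dird_basis dirdZ// dird_basis; ring.
have dd P Q S l : connv P (connv Q S x) x 0 l =
    \sum_i \sum_j \sum_k (\sum_p christoffel G l i p x * christoffel G p j k x)
       * P 0 i * Q 0 j * S 0 k.
  rewrite mxE; apply: eq_bigr => i _.
  under eq_bigr do rewrite mxE mulr_sumr.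
  rewrite exchange_big; apply: eq_bigr => j _ /=.
  under eq_bigr do rewrite mulr_sumr.
  rewrite exchange_big; apply: eq_bigr => k _ /=.
  rewrite !mulr_suml; apply: eq_bigr => p _; ring.
apply/rowP => l; have := dd X Y Z l; have := dd Y X Z l.
move: (connv X _ x) (connv Y _ x) => c1 c2 e2 e1.
rewrite !mxE e1 e2 !dc.
rewrite [X in _ - X + _]exchange_big [X in _ = _ - X]exchange_big /=.
rewrite -!sumrB -big_split -sumrB; apply: eq_bigr => i _ /=.
rewrite -!sumrB -big_split -sumrB; apply: eq_bigr => j _ /=.
rewrite -!sumrB -big_split -sumrB; apply: eq_bigr => k _ /=.
rewrite /riemann big_split /= sumrN.
move: (\sum_p christoffel G l i p x * christoffel G p j k x)
  (\sum_p christoffel G l j p x * christoffel G p i k x) => s1 s2.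
by move: (pd i _ x) (pd j _ x) => d1 d2; ring.
Qed.

(** Integration by parts: <nabla_X nabla_Y Z, W> = X <nabla_Y Z, W> - <nabla_Y Z, nabla_X W>.
    Derivatives of Christoffel symbols become derivatives of Koszul pairings. *)
Lemma ip_curv x X Y Z W :
  (\forall u \near x, [/\ metric_pdable u, (G u)^T = G u & G u \in unitmx]) ->
  (forall k i j, pdable (christoffel G k i j) x) ->
  ip G x (curv G x X Y Z) W =
  dird X (koszul Y Z W) x - dird Y (koszul X Z W) x
  - ip G x (connv X W x) (connv Y Z x) + ip G x (connv Y W x) (connv X Z x).
Proof.
move=> regG dC; have [dG sG uG] := nbhs_singleton regG.
have symG : \forall u \near x, (G u)^T = G u by apply: filterS regG => u [].
have dcv P Q l : pdable (fun u => connv P Q u 0 l) x.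
  under eq_fun do rewrite mxE.
  do 2!apply: pdable_sum => ?; apply: pdableM; last exact: pdable_cst.
  by apply: pdableM => //; exact: pdable_cst.
(* This is metric compatibility for the non-constant field nabla_Q S against the constant field W:
   the product rule differentiates the components of nabla_Q S and the metric coefficients
   separately. *)
have key P Q S : dird P (koszul Q S W) x =
    ip G x (\row_l dird P (fun u => connv Q S u 0 l) x) W
    + ip G x (connv P (connv Q S x) x) W + ip G x (connv P W x) (connv Q S x).
  rewrite !ip_connv// -addrA -dird_ip_koszul//.
  have -> : dird P (koszul Q S W) x = dird P (fun u =>
      \sum_i \sum_j connv Q S u 0 i * G u i j * W 0 j) x.
    apply: dird_near; apply: filterS regG => u [du su uu].
    by rewrite -ip_connv// ipE.
  rewrite dird_sum => [|i]; last first.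
    apply: pdable_sum => j.
    by apply: pdableM; [apply: pdableM|exact: pdable_cst].
  rewrite dird_ip// [X in _ = _ + X]exchange_big ipE -big_split.
  apply: eq_bigr => i _ /=.
  rewrite dird_sum => [|j]; last first.
    by apply: pdableM; [apply: pdableM|exact: pdable_cst].
  rewrite [X in _ = _ + X]exchange_big -big_split; apply: eq_bigr => j _ /=.
  under [X in dird _ X]eq_fun do rewrite mulrC.
  rewrite dirdZ ?dirdM//; last exact: pdableM.
  rewrite [X in _ = X * _ * _ + _]mxE mulrDr addrC; congr (_ + _); first ring.
  by rewrite /dird !mulr_sumr; apply: eq_bigr => a _; ring.
rewrite curvE// !key !ipDl !ipNl.
by do 6!move: (ip G x _ _) => ?; ring.
Qed.

End MetricDerivatives.

(** * Functions with second partial derivatives, and invariance under translations *)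

Section TwiceDifferentiable.
Variables (R : realType) (n : nat) (W : set 'rV[R]_n.+1).
Hypothesis oW : open W.
Implicit Types (f g : 'rV[R]_n.+1 -> R) (x Y Z : 'rV[R]_n.+1).

(** The class is stable under sums, products, inverses and square roots, so it passes from phi and
    eta to all the metric coefficients. *)
Record C2on f : Prop := IsC2on {
  C2on_pdable : forall u, W u -> pdable f u;
  C2on_pd : forall a u, W u -> pdable (pd a f) u }.

Lemma near_open (P : 'rV[R]_n.+1 -> Prop) x : W x ->
  (forall u, W u -> P u) -> \forall u \near x, P u.
Proof. by move=> Wx WP; apply: filterS WP _; exact: open_nbhs_nbhs. Qed.

Lemma C2on_dird f Y u : C2on f -> W u -> pdable (dird Y f) u.
Proof. by move=> Cf Wu; apply: pdable_dird => a; exact: C2on_pd. Qed.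

Lemma C2on_eq f g : (forall u, W u -> f u = g u) -> C2on f -> C2on g.
Proof.
move=> fg Cf; split=> [u|a u] Wu.
  by have /pdable_near := C2on_pdable Cf Wu; apply; exact: near_open.
have /pdable_near := C2on_pd Cf (a := a) Wu; apply; apply: near_open => // y Wy.
by apply: pd_near; exact: near_open.
Qed.

Lemma C2on_cst c : C2on (fun=> c).
Proof.
split=> [u|a u] _; first exact: pdable_cst.
suff -> : pd a (fun=> c) = (fun=> 0) by exact: pdable_cst.
by apply/funext => y; rewrite pd_cst.
Qed.

Lemma C2onD f g : C2on f -> C2on g -> C2on (fun y => f y + g y).
Proof.
move=> [df ddf] [dg ddg]; split=> [u|a u] Wu.
  by apply: pdableD; [exact: df|exact: dg].
have /pdable_near := pdableD (ddf a u Wu) (ddg a u Wu); apply.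
by apply: near_open => // y Wy; rewrite pdD; [|exact: df|exact: dg].
Qed.

Lemma C2onM f g : C2on f -> C2on g -> C2on (fun y => f y * g y).
Proof.
move=> [df ddf] [dg ddg]; split=> [u|a u] Wu.
  by apply: pdableM; [exact: df|exact: dg].
have /pdable_near := pdableD (pdableM (df u Wu) (ddg a u Wu))
  (pdableM (dg u Wu) (ddf a u Wu)); apply.
by apply: near_open => // y Wy; rewrite pdM; [|exact: df|exact: dg].
Qed.

Lemma C2onV f : (forall u, W u -> f u != 0) -> C2on f ->
  C2on (fun y => (f y)^-1).
Proof.
move=> f0 [df ddf]; split=> [u|a u] Wu.
  by apply: pdableV; [exact: f0|exact: df].
have dff : pdable (fun y => (f y * f y)^-1) u.
  by apply: pdableV; [rewrite mulf_neq0 ?f0|apply: pdableM; exact: df].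
have /pdable_near := pdableM (pdableN dff) (ddf a u Wu); apply.
apply: near_open => // y Wy.
by rewrite pdV; [rewrite expr2|exact: f0|exact: df].
Qed.

Lemma C2on_sum k (h : 'I_k -> 'rV[R]_n.+1 -> R) :
  (forall i, C2on (h i)) -> C2on (fun y => \sum_i h i y).
Proof.
elim: k h => [|k IHk] h Ch.
  by apply: C2on_eq _ (C2on_cst 0) => u _; rewrite big_ord0.
apply: C2on_eq _ (C2onD (Ch ord0) (IHk _ (fun i => Ch (lift ord0 i)))) => u _.
by rewrite big_ord_recl.
Qed.

Lemma dird2M Y Z f g x : C2on f -> C2on g -> W x ->
  dird Y (dird Z (fun y => f y * g y)) x =
  f x * dird Y (dird Z g) x + dird Y f x * dird Z g x
  + dird Z f x * dird Y g x + g x * dird Y (dird Z f) x.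
Proof.
move=> Cf Cg Wx; have df := C2on_pdable Cf Wx; have dg := C2on_pdable Cg Wx.
have -> : dird Y (dird Z (fun y => f y * g y)) x =
    dird Y (fun u => f u * dird Z g u + g u * dird Z f u) x.
  apply: dird_near; apply: near_open => // u Wu; apply: dirdM.
    exact: (C2on_pdable Cf).
  exact: (C2on_pdable Cg).
have dZf := C2on_dird (Y := Z) Cf Wx; have dZg := C2on_dird (Y := Z) Cg Wx.
rewrite (dirdD _ (pdableM df dZg) (pdableM dg dZf)).
rewrite (dirdM _ df dZg) (dirdM _ dg dZf).
by do ?[move: (dird _ _ _) => ?]; ring.
Qed.

Lemma dird2D Y Z f g x : C2on f -> C2on g -> W x ->
  dird Y (dird Z (fun y => f y + g y)) x =
  dird Y (dird Z f) x + dird Y (dird Z g) x.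
Proof.
move=> Cf Cg Wx.
rewrite -(dirdD _ (C2on_dird (Y := Z) Cf Wx) (C2on_dird (Y := Z) Cg Wx)).
apply: dird_near; apply: near_open => // u Wu; apply: dirdD.
  exact: (C2on_pdable Cf).
exact: (C2on_pdable Cg).
Qed.

Lemma dird2V Y Z f x : (forall u, W u -> f u != 0) -> C2on f -> W x ->
  dird Y (dird Z (fun y => (f y)^-1)) x =
  2 * dird Y f x * dird Z f x / f x ^+ 3 - dird Y (dird Z f) x / f x ^+ 2.
Proof.
move=> f0 Cf Wx; have df := C2on_pdable Cf Wx; have fx := f0 _ Wx.
have dff : pdable (fun y => f y * f y) x by exact: pdableM.
have ff0 : f x * f x != 0 by rewrite mulf_neq0.
have dZf := C2on_dird (Y := Z) Cf Wx.
have -> : dird Y (dird Z (fun y => (f y)^-1)) x =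
    dird Y (fun u => - (f u * f u)^-1 * dird Z f u) x.
  apply: dird_near; apply: near_open => // u Wu.
  by rewrite dirdV ?expr2; [|exact: f0|exact: (C2on_pdable Cf)].
have dffV := pdableV ff0 dff.
rewrite (dirdM _ (pdableN dffV) dZf) (dirdN _ dffV) (dirdV _ ff0 dff).
rewrite (dirdM _ df df).
by do ?[move: (dird _ _ _) => ?]; field.
Qed.

Variable v : 'rV[R]_n.+1.

Definition invariant_on f : Prop := forall u s, W u -> f (u + s *: v) = f u.

(** Differentiation commutes with translation, and the translate of f agrees with f on the open set
    W. Invariance thus passes to Koszul pairings, whose fibre derivatives vanish. *)
Lemma pd_invariant a f : invariant_on f -> invariant_on (pd a f).
Proof.
move=> fv u s Wu.
have -> : pd a f (u + s *: v) = pd a (fun y => f (y + s *: v)) u.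
  rewrite /pd /derive; set t := s *: v.
  by rewrite (_ : _ \o shift (u + t) = (fun y => f (y + t)) \o shift u)//;
    apply/funext => h /=; rewrite addrA.
by apply: pd_near; apply: near_open => // y Wy; exact: fv.
Qed.

Lemma dird_invariant Y f : invariant_on f -> invariant_on (dird Y f).
Proof.
by move=> fv u s Wu; apply: eq_bigr => a _; rewrite pd_invariant.
Qed.

Lemma derive_invariant f u : invariant_on f -> W u -> 'D_v f u = 0.
Proof.
move=> fv Wu; rewrite /derive.
rewrite (_ : (fun h => _) = fun=> 0); first by rewrite lim_cst.
by apply/funext => h /=; rewrite (addrC (h *: v)) fv// subrr scaler0.
Qed.

End TwiceDifferentiable.

(** * Differentiability of the inverse matrix and of the Christoffel symbols *)

Section InverseMatrix.
Variables (R : realType) (n : nat).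

Lemma pdable_big_sum (I : Type) (r : seq I) (P : pred I)
    (h : I -> 'rV[R]_n.+1 -> R) x :
  (forall i, pdable (h i) x) -> pdable (fun y => \sum_(i <- r | P i) h i y) x.
Proof.
move=> dh; elim: r => [|i r IHr].
  by under eq_fun do rewrite big_nil; exact: pdable_cst.
under eq_fun do rewrite big_cons.
case: (P i); last exact: IHr.
exact: pdableD (dh i) IHr.
Qed.

Lemma pdable_big_prod (I : Type) (r : seq I) (P : pred I)
    (h : I -> 'rV[R]_n.+1 -> R) x :
  (forall i, pdable (h i) x) -> pdable (fun y => \prod_(i <- r | P i) h i y) x.
Proof.
move=> dh; elim: r => [|i r IHr].
  by under eq_fun do rewrite big_nil; exact: pdable_cst.
under eq_fun do rewrite big_cons.
case: (P i); last exact: IHr.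
exact: pdableM (dh i) IHr.
Qed.

Lemma pdable_det k (M : 'rV[R]_n.+1 -> 'M[R]_k) x :
  (forall i j, pdable (fun y => M y i j) x) -> pdable (fun y => \det (M y)) x.
Proof.
move=> dM; apply: pdable_big_sum => s; apply: pdableZ.
exact: pdable_big_prod.
Qed.

(** Cramer's rule: near x the inverse is the adjugate divided by the determinant, both polynomial in
    the entries. *)
Lemma pdable_invmx k (M : 'rV[R]_n.+1 -> 'M[R]_k) x i j :
  (\forall y \near x, M y \in unitmx) ->
  (forall i j, pdable (fun y => M y i j) x) ->
  pdable (fun y => invmx (M y) i j) x.
Proof.
move=> uM dM.
have : pdable (fun y => (\det (M y))^-1 * cofactor (M y) j i) x.
  apply: pdableM; last first.
    apply: pdableZ; apply: pdable_det => a b.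
    by under eq_fun do rewrite !mxE; exact: dM.
  apply: pdableV; last exact: pdable_det.
  by have := nbhs_singleton uM; rewrite unitmxE unitfE.
apply: pdable_near; near=> y.
rewrite /invmx (_ : M y \in unitmx) ?mxE ?mxE//; by near: y.
Unshelve. all: by end_near. Qed.

Lemma pdable_christoffel (G : 'rV[R]_n.+1 -> 'M[R]_n.+1) x k i j :
  (\forall y \near x, G y \in unitmx) -> metric_pdable G x ->
  (forall a i j, pdable (pd a (fun y => G y i j)) x) ->
  pdable (christoffel G k i j) x.
Proof.
move=> uG dG ddG; apply: pdableZ; apply: pdable_sum => l; apply: pdableM.
  exact: pdable_invmx.
by apply: pdableD; [exact: pdableD|exact: pdableN].
Qed.

End InverseMatrix.

(** * Multilinearity of the connection and curvature contractions *)

Section Multilinearity.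
Variables (R : realType) (n : nat) (G : 'rV[R]_n.+1 -> 'M[R]_n.+1).
Implicit Types (x X Y Z : 'rV[R]_n.+1).

Lemma connvDl X X' Y x : connv G (X + X') Y x = connv G X Y x + connv G X' Y x.
Proof.
apply/rowP => k; rewrite !mxE -big_split; apply: eq_bigr => i _ /=.
by rewrite -big_split; apply: eq_bigr => j _; rewrite mxE /=; ring.
Qed.

Lemma connvDr X Y Y' x : connv G X (Y + Y') x = connv G X Y x + connv G X Y' x.
Proof.
apply/rowP => k; rewrite !mxE -big_split; apply: eq_bigr => i _ /=.
by rewrite -big_split; apply: eq_bigr => j _; rewrite mxE /=; ring.
Qed.

Lemma connvZl c X Y x : connv G (c *: X) Y x = c *: connv G X Y x.
Proof.
apply/rowP => k; rewrite !mxE mulr_sumr; apply: eq_bigr => i _ /=.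
by rewrite mulr_sumr; apply: eq_bigr => j _; rewrite mxE /=; ring.
Qed.

Lemma connvZr c X Y x : connv G X (c *: Y) x = c *: connv G X Y x.
Proof.
apply/rowP => k; rewrite !mxE mulr_sumr; apply: eq_bigr => i _ /=.
by rewrite mulr_sumr; apply: eq_bigr => j _; rewrite mxE /=; ring.
Qed.

Lemma connv_suml k (X : 'I_k -> 'rV[R]_n.+1) Y x :
  connv G (\sum_i X i) Y x = \sum_i connv G (X i) Y x.
Proof.
apply: (big_morph (fun X => connv G X Y x)) => [X1 X2|]; first exact: connvDl.
by rewrite -(scale0r (0 : 'rV[R]_n.+1)) connvZl !scale0r.
Qed.

Lemma connv_sumr k X (Y : 'I_k -> 'rV[R]_n.+1) x :
  connv G X (\sum_i Y i) x = \sum_i connv G X (Y i) x.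
Proof.
apply: (big_morph (fun Y => connv G X Y x)) => [Y1 Y2|]; first exact: connvDr.
by rewrite -(scale0r (0 : 'rV[R]_n.+1)) connvZr !scale0r.
Qed.

Lemma curvDl x X X' Y Z :
  curv G x (X + X') Y Z = curv G x X Y Z + curv G x X' Y Z.
Proof.
apply/rowP => l; rewrite !mxE -big_split; apply: eq_bigr => i _ /=.
rewrite -big_split; apply: eq_bigr => j _ /=.
by rewrite -big_split; apply: eq_bigr => k _; rewrite mxE /=; ring.
Qed.

Lemma curvZl x c X Y Z : curv G x (c *: X) Y Z = c *: curv G x X Y Z.
Proof.
apply/rowP => l; rewrite !mxE mulr_sumr; apply: eq_bigr => i _ /=.
rewrite mulr_sumr; apply: eq_bigr => j _ /=.
by rewrite mulr_sumr; apply: eq_bigr => k _; rewrite mxE /=; ring.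
Qed.

End Multilinearity.

(** * The second fundamental form paired with a normal vector *)

Section Submanifold.
Variables (R : realType) (n d : nat) (G : 'rV[R]_n.+1 -> 'M[R]_n.+1).
Variables (F : 'rV[R]_d.+1 -> 'rV[R]_n.+1) (w : 'rV[R]_d.+1).
Variable V : 'rV[R]_n.+1.
Hypotheses (symG : (G (F w))^T = G (F w)) (normV : is_normal G F w V).

Definition hess (a b : 'I_d.+1) : 'rV[R]_n.+1 :=
  \row_k pd a (pd b (fun y => F y 0 k)) w.

Lemma ip_push_normal X : ip G (F w) (push F w X) V = 0.
Proof.
rewrite ip_suml big1// => a _; rewrite ipZl ipC//.
by rewrite (normV a) mulr0.
Qed.

Lemma ip_normal_part Z : ip G (F w) (normal_part G F w Z) V = ip G (F w) Z V.
Proof.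
rewrite ipDl ipNl ip_suml big1 ?subr0// => a _.
rewrite ip_suml big1// => b _.
by rewrite ipZl [X in _ * X]ipC// normV mulr0.
Qed.

Lemma cov_derivE a b : cov_deriv G F w a b =
  hess a b + connv G (tangent F w a) (tangent F w b) (F w).
Proof. by apply/rowP => k; rewrite !mxE. Qed.

(** Pairing with a normal vector removes the tangential projection. If the second partials of F are
    orthogonal to V as well, only the Christoffel term is left, and it depends on the
    parametrisation only through the pushed vectors. *)
Lemma ip_second_form X Y : (forall a b, ip G (F w) (hess a b) V = 0) ->
  ip G (F w) (second_form G F w X Y) V =
  ip G (F w) (connv G (push F w X) (push F w Y) (F w)) V.
Proof.
move=> hessV; rewrite ip_normal_part /push connv_suml !ip_suml.
apply: eq_bigr => a _; rewrite connv_sumr !ip_suml; apply: eq_bigr => b _.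
rewrite connvZl connvZr cov_derivE !ipZl ipDl hessV add0r.
by rewrite mulrA.
Qed.

Lemma ip_simons_op e : (forall a b, ip G (F w) (hess a b) V = 0) ->
  ip G (F w) (simons_op G F w e V) V = \sum_i \sum_j
    ip G (F w) (connv G (push F w (e i)) (push F w (e j)) (F w)) V ^+ 2.
Proof.
move=> hessV; rewrite ip_suml; apply: eq_bigr => i _.
rewrite ip_suml; apply: eq_bigr => j _.
by rewrite ipZl -expr2 ip_second_form.
Qed.

End Submanifold.

(** * The Euclidean dot product and the projection to R^3 *)

Section DotProduct.
Variables (R : realType) (n : nat).
Implicit Types u v w : 'rV[R]_n.

Lemma dotvC v w : dotv v w = dotv w v.
Proof. by apply: eq_bigr => i _; rewrite mulrC. Qed.

Lemma dotvDr u v w : dotv u (v + w) = dotv u v + dotv u w.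
Proof.
by rewrite -big_split; apply: eq_bigr => i _ /=; rewrite mxE mulrDr.
Qed.

Lemma dotvZr c v w : dotv v (c *: w) = c * dotv v w.
Proof. by rewrite mulr_sumr; apply: eq_bigr => i _; rewrite mxE; ring. Qed.

Lemma dotv0r v : dotv v 0 = 0.
Proof. by apply: big1 => i _; rewrite mxE mulr0. Qed.

Lemma dotv_basis v i : dotv v (basis_vec R i) = v 0 i.
Proof.
rewrite /dotv (bigD1 i)//= big1 ?addr0 => [|j ji]; rewrite mxE eqxx /=.
  by rewrite eqxx mulr1.
by rewrite (negPf ji) mulr0.
Qed.

Lemma basis_sum v : v = \sum_i v 0 i *: basis_vec R i.
Proof. exact: row_sum_delta. Qed.

End DotProduct.

Local Notation j0 := (ord0 : 'I_3).
Local Notation j1 := (lift ord0 ord0 : 'I_3).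
Local Notation j2 := (lift ord0 (lift ord0 ord0) : 'I_3).

Section BasePoint.
Variable R : realType.
Implicit Types u v : 'rV[R]_4.

Lemma base_ptD u v : base_pt (u + v) = base_pt u + base_pt v.
Proof. by apply/rowP => i; rewrite !mxE. Qed.

Lemma base_ptZ c u : base_pt (c *: u) = c *: base_pt u.
Proof. by apply/rowP => i; rewrite !mxE. Qed.

Lemma base_pt_fibre : base_pt (fibre_vec R) = 0.
Proof. by apply/rowP => i; rewrite !mxE. Qed.

Lemma base_pt_basis i : base_pt (basis_vec R (lift ord0 i)) = basis_vec R i.
Proof. by apply/rowP => j; rewrite !mxE (inj_eq lift_inj). Qed.

End BasePoint.

(** * The metric of a potential phi and a connection form eta in bundle coordinates *)

Section GibbonsHawkingMetric.
Variables (R : realType) (W : set 'rV[R]_4).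
Variables (phi : 'rV[R]_4 -> R) (eta : 'rV[R]_4 -> 'rV[R]_4).
Local Notation xi := (fibre_vec R).
Hypotheses (oW : open W).
Hypotheses (phi_gt0 : forall u, W u -> 0 < phi u)
  (eta_fibre : forall u, W u -> eta u 0 ord0 = 1).
Hypotheses (C2phi : C2on W phi) (C2eta : forall i, C2on W (fun u => eta u 0 i)).
Hypotheses (phi_inv : invariant_on W xi phi)
  (eta_inv : forall i, invariant_on W xi (fun u => eta u 0 i)).

(** [gh_metric] with its potential abstracted to a function on bundle coordinates; the two are
    convertible when [phi] is the pulled-back potential. The relation d eta = star d phi is imposed
    later, at a single point. *)
Definition conn_metric (u : 'rV[R]_4) : 'M[R]_4 :=
  \matrix_(i, j) ((phi u)^-1 * (eta u 0 i * eta u 0 j)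
    + phi u * dotv (base_pt (basis_vec R i)) (base_pt (basis_vec R j))).

Local Notation g := conn_metric.

Definition conn_on (Y u : 'rV[R]_4) : R := dotv (eta u) Y.

Lemma ip_conn_metric u Y Z : ip g u Y Z =
  (phi u)^-1 * (conn_on Y u * conn_on Z u)
  + phi u * dotv (base_pt Y) (base_pt Z).
Proof.
have basE k (i : 'I_4) : base_pt (basis_vec R i) 0 k = (lift ord0 k == i)%:R.
  by rewrite !mxE eqxx.
rewrite ipE {1}/conn_on /dotv mulr_suml !mulr_sumr.
have -> : \sum_i phi u * (base_pt Y 0 i * base_pt Z 0 i) =
    \sum_i \sum_j phi u *
     (Y 0 i * dotv (base_pt (basis_vec R i)) (base_pt (basis_vec R j)) * Z 0 j).
  under [RHS]eq_bigr do under eq_bigr do rewrite mulr_sumr mulr_suml mulr_sumr.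
  under [RHS]eq_bigr do rewrite exchange_big.
  rewrite [RHS]exchange_big; apply: eq_bigr => k _ /=.
  rewrite (bigD1 (lift ord0 k))//= [X in _ + X]big1 ?addr0 => [|i ik].
    rewrite (bigD1 (lift ord0 k))//= big1 ?addr0 => [|i ik].
      by rewrite !basE eqxx !mxE !mulr1.
    by rewrite !basE [_ == i]eq_sym (negPf ik) !mulr0 mul0r mulr0.
  apply: big1 => j _.
  by rewrite !basE [_ == i]eq_sym (negPf ik) mul0r mulr0 mul0r mulr0.
rewrite -big_split; apply: eq_bigr => i _ /=.
rewrite (_ : conn_on Z u = \sum_j eta u 0 j * Z 0 j)// !mulr_sumr.
rewrite -big_split; apply: eq_bigr => j _ /=.
rewrite [g u i j]mxE; move: (dotv _ _) => ?; ring.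
Qed.

Lemma conn_onD Y Z u : conn_on (Y + Z) u = conn_on Y u + conn_on Z u.
Proof. exact: dotvDr. Qed.

Lemma conn_onZ c Y u : conn_on (c *: Y) u = c * conn_on Y u.
Proof. exact: dotvZr. Qed.

Lemma conn_on_fibre u : W u -> conn_on xi u = 1.
Proof. by move=> Wu; rewrite /conn_on dotv_basis eta_fibre. Qed.

Lemma C2on_conn_on Y : C2on W (conn_on Y).
Proof.
apply: C2on_sum => // i; apply: C2onM => //; exact: C2on_cst.
Qed.

Lemma conn_on_inv Y : invariant_on W xi (conn_on Y).
Proof.
by move=> u s Wu; apply: eq_bigr => i _; rewrite (eta_inv i).
Qed.

Let phi_neq0 u : W u -> phi u != 0.
Proof. by move=> /phi_gt0; rewrite lt0r => /andP[]. Qed.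

Lemma ip_conn_metricE Y Z : (fun u => ip g u Y Z) = (fun u =>
  (phi u)^-1 * (conn_on Y u * conn_on Z u)
  + phi u * dotv (base_pt Y) (base_pt Z)).
Proof. by apply/funext => u; rewrite ip_conn_metric. Qed.

Lemma C2on_metric_ip Y Z : C2on W (fun u => ip g u Y Z).
Proof.
rewrite ip_conn_metricE; apply: C2onD => //.
  apply: C2onM => //; first exact: C2onV.
  by apply: C2onM => //; exact: C2on_conn_on.
by apply: C2onM => //; exact: C2on_cst.
Qed.

Lemma metric_ip_inv Y Z : invariant_on W xi (fun u => ip g u Y Z).
Proof.
by move=> u s Wu; rewrite !ip_conn_metric phi_inv// !conn_on_inv.
Qed.

Lemma C2on_metric i j : C2on W (fun u => g u i j).
Proof.
have := C2on_metric_ip (basis_vec R i) (basis_vec R j).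
congr (C2on W _); apply/funext => u.
by rewrite ip_conn_metric mxE /conn_on !dotv_basis.
Qed.

Lemma metric_sym u : (g u)^T = g u.
Proof.
apply/matrixP => i j; rewrite !mxE [eta u 0 j * _]mulrC.
by rewrite (dotvC (base_pt (basis_vec R j))).
Qed.

(** Positive definiteness: for v in the kernel both nonnegative summands of g(v, v) vanish. The
    second kills the base part of v, after which eta(v) = 0 reads v_0 = 0. *)
Lemma metric_unit u : W u -> g u \in unitmx.
Proof.
move=> Wu; rewrite -row_free_unit; apply: inj_row_free => v vg.
have : ip g u v v = 0 by rewrite /ip vg mul0mx mxE.
have p0 := phi_gt0 Wu; have pV0 : 0 < (phi u)^-1 by rewrite invr_gt0.
have dv0 : 0 <= dotv (base_pt v) (base_pt v).
  by apply: sumr_ge0 => i _; rewrite -expr2 sqr_ge0.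
have cv0 : 0 <= conn_on v u * conn_on v u by rewrite -expr2 sqr_ge0.
move/eqP; rewrite ip_conn_metric paddr_eq0; last 2 first.
- by rewrite pmulr_rge0.
- by rewrite pmulr_rge0.
rewrite !mulf_eq0 (gt_eqF pV0) (gt_eqF p0) orbb /= => /andP[/eqP cv /eqP].
have sq k : true -> 0 <= base_pt v 0 k * base_pt v 0 k.
  by rewrite -expr2 sqr_ge0.
move/(psumr_eq0P sq) => bv; have {}bv i : v 0 (lift ord0 i) = 0.
  by have /eqP := bv i isT; rewrite mulf_eq0 orbb mxE => /eqP.
apply/rowP => i; rewrite mxE; case: (unliftP ord0 i) => [k ->|->] //.
move: cv; rewrite /conn_on /dotv big_ord_recl big1 ?addr0 => [|k _].
  by rewrite eta_fibre// mul1r.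
by rewrite bv mulr0.
Qed.

Lemma metric_pdableP u : W u -> metric_pdable g u.
Proof. by move=> Wu i j; apply: (C2on_pdable (C2on_metric i j)). Qed.

Lemma metric_christoffel_pdable u k i j : W u ->
  pdable (christoffel g k i j) u.
Proof.
move=> Wu; apply: pdable_christoffel.
- by apply: (near_open oW Wu) => y Wy; exact: metric_unit.
- exact: metric_pdableP.
- by move=> a b c; apply: (C2on_pd (C2on_metric b c)).
Qed.

Lemma metric_ip_curv u X Y Z V : W u ->
  ip g u (curv g u X Y Z) V =
  dird X (koszul g Y Z V) u - dird Y (koszul g X Z V) u
  - ip g u (connv g X V u) (connv g Y Z u)
  + ip g u (connv g Y V u) (connv g X Z u).
Proof.
move=> Wu; apply: ip_curv => [|k i j]; last exact: metric_christoffel_pdable.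
apply: (near_open oW Wu) => y Wy; split.
- exact: metric_pdableP.
- exact: metric_sym.
- exact: metric_unit.
Qed.

Lemma metric_ip_connv u X Y Z : W u ->
  ip g u (connv g X Y u) Z = koszul g X Y Z u.
Proof.
move=> Wu; apply: ip_connv; [exact: metric_pdableP|exact: metric_sym|].
exact: metric_unit.
Qed.

Lemma dird_fibre f u : invariant_on W xi f -> W u -> dird xi f u = 0.
Proof.
move=> fi Wu; rewrite /fibre_vec dird_basis; exact: (derive_invariant fi).
Qed.

Lemma koszul_inv X Y Z : invariant_on W xi (koszul g X Y Z).
Proof.
by move=> u s Wu; rewrite /koszul !(dird_invariant oW)//;
  exact: metric_ip_inv.
Qed.

Lemma conn_on_fibre_dird Y u : W u -> dird Y (conn_on xi) u = 0.
Proof.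
move=> Wu; rewrite -(dird_cst Y 1 u); apply: dird_near.
by apply: (near_open oW Wu) => y Wy; exact: conn_on_fibre.
Qed.

Lemma dird_metric_ip Y P Q u : W u -> dird Y (fun y => ip g y P Q) u =
  (phi u)^-1 * (conn_on P u * dird Y (conn_on Q) u
               + conn_on Q u * dird Y (conn_on P) u)
  + (dotv (base_pt P) (base_pt Q)
     - (phi u)^-1 ^+ 2 * (conn_on P u * conn_on Q u)) * dird Y phi u.
Proof.
move=> Wu; have p0 := phi_neq0 Wu; rewrite ip_conn_metricE.
have dphi := C2on_pdable C2phi Wu.
have dP := C2on_pdable (C2on_conn_on P) Wu.
have dQ := C2on_pdable (C2on_conn_on Q) Wu.
have dV := pdableV p0 dphi.
have dc : pdable (fun=> dotv (base_pt P) (base_pt Q)) u by exact: pdable_cst.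
rewrite (dirdD _ (pdableM dV (pdableM dP dQ)) (pdableM dphi dc)).
rewrite (dirdM _ dV (pdableM dP dQ)) (dirdM _ dphi dc) (dirdM _ dP dQ).
rewrite (dirdV _ p0 dphi) dird_cst -exprVn.
by move: (phi u)^-1 (dotv _ _) => ? ?; ring.
Qed.

(** The horizontal lift at x of a coordinate field, frozen to a constant field so that the Koszul
    and curvature formulas apply. At another point u its value under eta is eta_i(u) - eta_i(x). *)
Definition horiz (x : 'rV[R]_4) (i : 'I_3) : 'rV[R]_4 :=
  basis_vec R (lift ord0 i) - eta x 0 (lift ord0 i) *: xi.

Lemma conn_on_horiz x i u : W u ->
  conn_on (horiz x i) u = eta u 0 (lift ord0 i) - eta x 0 (lift ord0 i).
Proof.
move=> Wu; rewrite /horiz -scaleNr conn_onD conn_onZ conn_on_fibre// mulr1.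
by rewrite /conn_on dotv_basis.
Qed.

Lemma base_pt_horiz x i : base_pt (horiz x i) = basis_vec R i.
Proof.
by rewrite /horiz -scaleNr base_ptD base_ptZ base_pt_fibre scaler0 addr0
  base_pt_basis.
Qed.

Lemma dird_horiz f x i u : invariant_on W xi f -> W u ->
  dird (horiz x i) f u = pd (lift ord0 i) f u.
Proof.
move=> fi Wu; rewrite /horiz -scaleNr dirdDl dirdZl dird_fibre//.
by rewrite mulr0 addr0 dird_basis.
Qed.

Lemma dird_conn_onD Y P Q u : W u ->
  dird Y (conn_on (P + Q)) u = dird Y (conn_on P) u + dird Y (conn_on Q) u.
Proof.
move=> Wu; rewrite (_ : conn_on (P + Q) = fun y => conn_on P y + conn_on Q y).
  by apply: dirdD; exact: (C2on_pdable (C2on_conn_on _)).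
by apply/funext => y; rewrite conn_onD.
Qed.

Lemma dird_conn_onZ Y c P u : W u ->
  dird Y (conn_on (c *: P)) u = c * dird Y (conn_on P) u.
Proof.
move=> Wu; rewrite (_ : conn_on (c *: P) = fun y => c * conn_on P y).
  by apply: dirdZ; exact: (C2on_pdable (C2on_conn_on _)).
by apply/funext => y; rewrite conn_onZ.
Qed.

(** * Koszul pairings and second derivatives of the metric at one point *)

Section AtPoint.
Variables (x : 'rV[R]_4).
Hypothesis Wx : W x.
Implicit Types a b c : 'rV[R]_4.
Local Notation E a b := (dird a (conn_on b) x).
Local Notation p := (phi x).

Let px : p != 0. Proof. exact: phi_neq0. Qed.

(** The vectors xi and h_i are orthogonal at x, with squared lengths 1/phi and phi. Covariant
    derivatives are known only through their pairings, so this expansion is what evaluates the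
    products of two of them in [metric_ip_curv]. *)
Lemma ip_frame C C' : ip g x C C' =
  p * (ip g x C xi * ip g x C' xi)
  + p^-1 * \sum_i ip g x C (horiz x i) * ip g x C' (horiz x i).
Proof.
have dot0 v : dotv v (base_pt xi) = 0.
  by rewrite base_pt_fibre dotv0r.
rewrite !ip_conn_metric !dot0 conn_on_fibre//.
under eq_bigr do rewrite !ip_conn_metric conn_on_horiz// subrr !base_pt_horiz
  !dotv_basis !mulr0 !add0r mulrACA.
by rewrite -mulr_sumr /dotv; move: (\sum_i _) => s; field.
Qed.

Let conn_x : conn_on xi x = 1. Proof. exact: conn_on_fibre. Qed.

Let inv_ip a b := metric_ip_inv a b.
Let dotxr v : dotv v (base_pt xi) = 0.
Proof. by rewrite base_pt_fibre dotv0r. Qed.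
Let dotxl v : dotv (base_pt xi) v = 0.
Proof. by rewrite dotvC dotxr. Qed.

Let koszulE := (dird_metric_ip, conn_on_fibre_dird, dotxr, dotxl).

(* In the names below, f stands for the fibre direction and h for a direction
   that is horizontal at x. *)

Lemma koszul_fff : koszul g xi xi xi x = 0.
Proof.
by rewrite /koszul !(dird_fibre (inv_ip _ _))// addr0 subrr mulr0.
Qed.

Lemma koszul_ffh a : conn_on a x = 0 ->
  koszul g xi xi a x = dird a phi x / (2 * p ^+ 2).
Proof.
move=> a0; rewrite /koszul !(dird_fibre (inv_ip _ _))// !koszulE// conn_x.
by field.
Qed.

Lemma koszul_fhf a : conn_on a x = 0 ->
  koszul g xi a xi x = - dird a phi x / (2 * p ^+ 2).
Proof.
move=> a0; rewrite /koszul !(dird_fibre (inv_ip _ _))// !koszulE// conn_x.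
by field.
Qed.

Lemma koszul_hff a : conn_on a x = 0 ->
  koszul g a xi xi x = - dird a phi x / (2 * p ^+ 2).
Proof.
move=> a0; rewrite /koszul !(dird_fibre (inv_ip _ _))// !koszulE// conn_x.
by field.
Qed.

(** For constant fields [E a b - E b a] is d eta(a, b), the part of the derivative of eta that d phi
    controls. *)
Lemma koszul_fhh a b : conn_on a x = 0 -> conn_on b x = 0 ->
  koszul g xi a b x = (E a b - E b a) / (2 * p).
Proof.
move=> a0 b0; rewrite /koszul (dird_fibre (inv_ip _ _))// !koszulE//.
by rewrite conn_x a0 b0; field.
Qed.

Lemma koszul_hfh a b : conn_on a x = 0 -> conn_on b x = 0 ->
  koszul g a xi b x = (E a b - E b a) / (2 * p).
Proof.
move=> a0 b0; rewrite /koszul (dird_fibre (inv_ip _ _))// !koszulE//.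
by rewrite conn_x a0 b0; field.
Qed.

(** The symmetric combination of derivatives of eta is not tensorial: it reflects that the constant
    fields a and b leave the horizontal distribution away from x. *)
Lemma koszul_hhf a b : conn_on a x = 0 -> conn_on b x = 0 ->
  koszul g a b xi x = (E a b + E b a) / (2 * p).
Proof.
move=> a0 b0; rewrite /koszul (dird_fibre (inv_ip _ _))// !koszulE//.
by rewrite conn_x a0 b0; field.
Qed.

Lemma koszul_hhh a b c :
  conn_on a x = 0 -> conn_on b x = 0 -> conn_on c x = 0 ->
  koszul g a b c x = 2^-1 * (dird a phi x * dotv (base_pt b) (base_pt c)
    + dird b phi x * dotv (base_pt a) (base_pt c)
    - dird c phi x * dotv (base_pt a) (base_pt b)).
Proof.
move=> a0 b0 c0; rewrite /koszul !dird_metric_ip// a0 b0 c0.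
by rewrite !(mul0r, mulr0, addr0, add0r, subr0); congr (_ * _); ring.
Qed.

Lemma dird2_eq Y Z f f' : (forall u, W u -> f u = f' u) ->
  dird Y (dird Z f) x = dird Y (dird Z f') x.
Proof.
move=> ff'; apply: dird_near; apply: (near_open oW Wx) => u Wu.
by apply: dird_near; exact: (near_open oW Wu).
Qed.

Lemma dird2_ip_ff Y Z : dird Y (dird Z (fun u => ip g u xi xi)) x =
  2 * dird Y phi x * dird Z phi x / p ^+ 3 - dird Y (dird Z phi) x / p ^+ 2.
Proof.
rewrite (@dird2_eq _ _ _ (fun u => (phi u)^-1)) => [|u Wu].
  by rewrite (dird2V oW _ _ phi_neq0 C2phi Wx).
by rewrite ip_conn_metric dotxr conn_on_fibre// mulr0 addr0 !mulr1.
Qed.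

(** Both factors of eta(a) eta(b) vanish at x, so in the second derivative of their product over phi
    only the terms that differentiate each factor once survive. *)
Lemma dird2_ip_hh Y Z a b : conn_on a x = 0 -> conn_on b x = 0 ->
  dird Y (dird Z (fun u => ip g u a b)) x =
  p^-1 * (E Y a * E Z b + E Z a * E Y b)
  + dotv (base_pt a) (base_pt b) * dird Y (dird Z phi) x.
Proof.
move=> a0 b0; rewrite ip_conn_metricE.
have CV := C2onV oW phi_neq0 C2phi.
have Ca := C2on_conn_on a; have Cb := C2on_conn_on b.
have Cab := C2onM oW Ca Cb.
have Cc : C2on W (fun=> dotv (base_pt a) (base_pt b)) by exact: C2on_cst.
rewrite (dird2D oW _ _ (C2onM oW CV Cab) (C2onM oW C2phi Cc) Wx).
rewrite (dird2M oW _ _ CV Cab Wx) (dird2M oW _ _ C2phi Cc Wx).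
rewrite (dird2M oW _ _ Ca Cb Wx).
rewrite !(dirdM _ (C2on_pdable Ca Wx) (C2on_pdable Cb Wx)) a0 b0.
have -> (s : R) : dird Y (dird Z (fun=> s)) x = 0.
  rewrite -(dird_cst Y 0 x); apply: dird_near.
  by apply: (near_open oW Wx) => u _; rewrite dird_cst.
rewrite !dird_cst; do ?[move: (dird _ _ x) => ?].
by move: p^-1 p (dotv _ _) => ? ? ?; ring.
Qed.

(** * Curvature at a point where d phi = q dx_2 *)

Section OnAxis.
Variables (q v1 v2 : R).
Local Notation P i j := (pd (lift ord0 i) (fun u => eta u 0 (lift ord0 j)) x).
Hypotheses (phi_1 : pd (lift ord0 j0) phi x = 0)
  (phi_2 : pd (lift ord0 j1) phi x = q) (phi_3 : pd (lift ord0 j2) phi x = 0).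
Hypotheses (curl12 : P j0 j1 = P j1 j0) (curl31 : P j2 j0 = P j0 j2 + q)
  (curl23 : P j1 j2 = P j2 j1).

Local Notation h i := (horiz x i).
Variable V : 'rV[R]_4.
Hypothesis V_def : V = v1 *: h j0 + v2 *: h j1.

Lemma conn_horiz0 i : conn_on (h i) x = 0.
Proof. by rewrite conn_on_horiz// subrr. Qed.

Lemma conn_normal0 : conn_on V x = 0.
Proof. by rewrite V_def conn_onD !conn_onZ !conn_horiz0 !mulr0 addr0. Qed.

Lemma dird_conn_horiz Y i :
  dird Y (conn_on (h i)) x = dird Y (fun u => eta u 0 (lift ord0 i)) x.
Proof.
have dE := C2on_pdable (C2eta (lift ord0 i)) Wx.
have dc : pdable (fun=> - eta x 0 (lift ord0 i)) x by exact: pdable_cst.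
rewrite -[RHS]addr0 -(dird_cst Y (- eta x 0 (lift ord0 i)) x) -(dirdD _ dE dc).
by apply: dird_near; apply: (near_open oW Wx) => u Wu; rewrite conn_on_horiz.
Qed.

Lemma conn_on_dird_horiz i j : E (h i) (h j) = P i j.
Proof. by rewrite dird_conn_horiz dird_horiz//; exact: eta_inv. Qed.

Lemma dotv_horiz i j : dotv (base_pt (h i)) (base_pt (h j)) = (i == j)%:R.
Proof. by rewrite !base_pt_horiz dotv_basis mxE eqxx eq_sym. Qed.

Let dphi1 : dird (h j0) phi x = 0. Proof. by rewrite dird_horiz. Qed.
Let dphi2 : dird (h j1) phi x = q. Proof. by rewrite dird_horiz. Qed.
Let dphi3 : dird (h j2) phi x = 0. Proof. by rewrite dird_horiz. Qed.

Let dphiV : dird V phi x = v2 * q.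
Proof. by rewrite V_def dirdDl !dirdZl dphi1 dphi2 mulr0 add0r. Qed.

Let conn_Vh i : E V (h i) = v1 * P j0 i + v2 * P j1 i.
Proof. by rewrite V_def dirdDl !dirdZl !conn_on_dird_horiz. Qed.

Let conn_hV i : E (h i) V = v1 * P i j0 + v2 * P i j1.
Proof.
by rewrite V_def dird_conn_onD// !dird_conn_onZ// !conn_on_dird_horiz.
Qed.

Let conn_VV : E V V = v1 * (v1 * P j0 j0 + v2 * P j1 j0)
  + v2 * (v1 * P j0 j1 + v2 * P j1 j1).
Proof.
by rewrite [X in conn_on X]V_def dird_conn_onD// !dird_conn_onZ// !conn_Vh.
Qed.

Let base_V : base_pt V = v1 *: base_pt (h j0) + v2 *: base_pt (h j1).
Proof. by rewrite V_def base_ptD !base_ptZ. Qed.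

Let dot_Vh i : dotv (base_pt V) (base_pt (h i)) =
  v1 * (j0 == i)%:R + v2 * (j1 == i)%:R.
Proof.
by rewrite base_V dotvC dotvDr !dotvZr ![dotv (base_pt (h i)) _]dotvC
  !dotv_horiz.
Qed.

Let dot_VV : dotv (base_pt V) (base_pt V) = v1 ^+ 2 + v2 ^+ 2.
Proof.
rewrite {2}base_V dotvDr !dotvZr.
by rewrite !dot_Vh /= !(mulr0, mulr1, addr0, add0r) !expr2.
Qed.

Let sum3 (F : 'I_3 -> R) : \sum_i F i = F j0 + F j1 + F j2.
Proof. by rewrite !big_ord_recl big_ord0 addr0 addrA. Qed.

(** Invariance makes the derivative along xi vanish, and near x the other Koszul pairing is half of
    V <xi, xi> = V(1/phi). The rest is quadratic in first derivatives; the hypotheses on the curl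
    eliminate the derivatives of eta. *)
Lemma curv_fibre : ip g x (curv g x xi V V) xi =
  dird V (dird V phi) x / (2 * p ^+ 2)
  + (2^-1 * q ^+ 2 * (v1 ^+ 2 + v2 ^+ 2) - 3 / 2 * (v2 * q) ^+ 2) / p ^+ 3.
Proof.
have nV := conn_normal0; have nh := conn_horiz0.
rewrite metric_ip_curv// (dird_fibre (koszul_inv _ _ _))//.
have -> : dird V (koszul g xi V xi) x =
    2^-1 * dird V (dird V (fun u => ip g u xi xi)) x.
  have dxx := C2on_dird (Y := V) (C2on_metric_ip xi xi) Wx.
  rewrite -(dirdZ _ _ dxx); apply: dird_near; apply: (near_open oW Wx) => u Wu.
  rewrite /koszul !(dird_fibre (inv_ip _ _))//.
  by rewrite add0r subr0.
rewrite dird2_ip_ff (ip_frame _ (connv _ V V x)).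
rewrite (ip_frame _ (connv _ xi V x)) !sum3.
have kE Y Z T := metric_ip_connv Y Z T Wx; rewrite !kE.
have k2 i := koszul_ffh (nh i); have k4 i := koszul_hhh nV nV (nh i).
have k6 i := koszul_hfh nV (nh i); have k8 i := koszul_fhh nV (nh i).
rewrite koszul_fff !k2 (koszul_hhf nV nV) !k4 (koszul_hff nV) !k6.
rewrite (koszul_fhf nV) !k8 dot_VV !dot_Vh !conn_Vh !conn_hV.
rewrite dphiV dphi1 dphi2 dphi3 conn_VV curl12 curl31 curl23 /=.
move: (dird _ (dird _ _) _) (P j0 j0) (P j1 j0) (P j0 j2) => ? ? ? ?.
move: (P j2 j1) (P j1 j1) => ? ?.
by field.
Qed.

(** The mixed derivative of phi along h_3 and V disappears because V and h_3 have orthogonal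
    projections. The derivatives of eta from the second derivatives of the metric cancel those from
    the quadratic terms. *)
Lemma curv_axis : ip g x (curv g x (h j2) V V) (h j2) =
  - (dird (h j2) (dird (h j2) phi) x * (v1 ^+ 2 + v2 ^+ 2) / 2)
  - dird V (dird V phi) x / 2
  + (3 / 2 * (v2 * q) ^+ 2 - q ^+ 2 * (v1 ^+ 2 + v2 ^+ 2)) / p.
Proof.
have nV := conn_normal0; have nh := conn_horiz0.
have dd a b c : pdable (dird a (fun u => ip g u b c)) x.
  exact: (C2on_dird (C2on_metric_ip b c) Wx).
have dZ a b c (s : R) : pdable (fun y => s * dird a (fun u => ip g u b c) y) x.
  by apply: pdableZ; exact: dd.
have sym a b : (fun u => ip g u a b) = (fun u => ip g u b a).
  by apply/funext => u; rewrite ipC ?metric_sym.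
rewrite metric_ip_curv//.
(* Repeated arguments simplify both Koszul pairings on a whole neighbourhood: this one is V <V, h_3>
   - h_3 <V, V> / 2, and the next is V <h_3, h_3> / 2. *)
have -> : dird (h j2) (koszul g V V (h j2)) x =
    dird (h j2) (dird V (fun u => ip g u V (h j2))) x
    + (- 2^-1) * dird (h j2) (dird (h j2) (fun u => ip g u V V)) x.
  rewrite -(dirdZ _ _ (dd _ _ _)) -(dirdD _ (dd _ _ _) (dZ _ _ _ _)).
  apply: dird_near; apply: (near_open oW Wx) => u _; rewrite /koszul.
  by move: (dird _ _ _) (dird _ _ _) => ? ?; field.
have -> : dird V (koszul g (h j2) V (h j2)) x =
    2^-1 * dird V (dird V (fun u => ip g u (h j2) (h j2))) x.
  rewrite -(dirdZ _ _ (dd _ _ _)).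
  apply: dird_near; apply: (near_open oW Wx) => u _; rewrite /koszul.
  rewrite (sym V (h j2)).
  by move: (dird _ _ _) (dird _ _ _) => ? ?; field.
rewrite (dird2_ip_hh _ _ nV (nh _)) (dird2_ip_hh _ _ nV nV).
rewrite (dird2_ip_hh _ _ (nh _) (nh _)) (ip_frame _ (connv _ V V x)).
rewrite (ip_frame _ (connv _ (h j2) V x)) !sum3.
have kE Y Z T := metric_ip_connv Y Z T Wx; rewrite !kE.
have k1 i j l := koszul_hhh (nh i) (nh j) (nh l).
have k2 i := koszul_hhh nV nV (nh i).
have k3 i j := koszul_hhh nV (nh i) (nh j).
have k4 i j := koszul_hhh (nh i) nV (nh j).
rewrite !k1 !k2 !k3 !k4 (koszul_hhf (nh j2) (nh j2)) (koszul_hhf nV nV).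
rewrite (koszul_hhf (nh j2) nV) (koszul_hhf nV (nh j2)).
have dot_hV i := etrans (dotvC (base_pt (h i)) (base_pt V)) (dot_Vh i).
rewrite dot_VV !dot_hV !dot_Vh !dotv_horiz !conn_Vh !conn_hV.
rewrite !conn_on_dird_horiz dphiV dphi1 dphi2 dphi3 conn_VV.
rewrite curl12 curl31 curl23 /=.
move: (dird (h j2) (dird (h j2) phi) x) (dird V (dird V phi) x) => ? ?.
move: (dird (h j2) (dird V phi) x) (P j0 j0) (P j1 j0) (P j0 j2) => ? ? ? ?.
move: (P j2 j1) (P j1 j1) (P j2 j2) => ? ? ?.
by field.
Qed.

Lemma horiz_decomp Y :
  Y = conn_on Y x *: xi + \sum_i Y 0 (lift ord0 i) *: h i.
Proof.
have -> : conn_on Y x = Y 0 ord0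
    + \sum_i eta x 0 (lift ord0 i) * Y 0 (lift ord0 i).
  by rewrite /conn_on /dotv big_ord_recl eta_fibre// mul1r.
rewrite {1}(basis_sum Y) big_ord_recl scalerDl -addrA; congr (_ + _).
rewrite scaler_suml -big_split; apply: eq_bigr => i _ /=.
by rewrite /horiz scalerBr scalerA [eta x _ _ * _]mulrC addrC subrK.
Qed.

(** Orthonormal rows of a square matrix give orthonormal columns. With rows (al i, be i) and weights
    1/p and p, the hypothesis says that [N] is a right inverse of [M]; that it is also a left
    inverse yields the three sums. *)
Lemma orthonormal_coef (al be : 'I_2 -> R) :
  (forall i j, p^-1 * (al i * al j) + p * (be i * be j) = (i == j)%:R) ->
  [/\ \sum_i al i ^+ 2 = p, \sum_i al i * be i = 0 & \sum_i be i ^+ 2 = p^-1].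
Proof.
move=> on.
pose M : 'M[R]_2 := \matrix_(i, j) (if j == 0 then al i else be i).
pose N : 'M[R]_2 := \matrix_(j, i) (if j == 0 then p^-1 * al i else p * be i).
have /mulmx1C NM : M *m N = 1%:M.
  apply/matrixP => i j; rewrite !mxE !big_ord_recl big_ord0 !mxE /= addr0.
  by rewrite -on; move: p^-1 p => ? ?; ring.
have NE j k : \sum_i N j i * M i k = (j == k)%:R.
  by have /matrixP/(_ j k) := NM; rewrite !mxE.
have E00 : \sum_i p^-1 * al i * al i = 1.
  by apply: etrans (NE 0 0); apply: eq_bigr => i _; rewrite !mxE.
have E01 : \sum_i p^-1 * al i * be i = 0.
  by apply: etrans (NE 0 1); apply: eq_bigr => i _; rewrite !mxE.
have E11 : \sum_i p * be i * be i = 1.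
  by apply: etrans (NE 1 1); apply: eq_bigr => i _; rewrite !mxE.
split.
- transitivity (p * \sum_i p^-1 * al i * al i); last by rewrite E00 mulr1.
  by rewrite mulr_sumr; apply: eq_bigr => i _; field.
- transitivity (p * \sum_i p^-1 * al i * be i); last by rewrite E01 mulr0.
  by rewrite mulr_sumr; apply: eq_bigr => i _; field.
- transitivity (p^-1 * \sum_i p * be i * be i); last by rewrite E11 mulr1.
  by rewrite mulr_sumr; apply: eq_bigr => i _; field.
Qed.

Lemma frame_sums (e : 'I_2 -> 'rV[R]_4) (al be : 'I_2 -> R) :
  (forall i, e i = al i *: xi + be i *: h j2) ->
  (forall i j, ip g x (e i) (e j) = (i == j)%:R) ->
  [/\ \sum_i al i ^+ 2 = p, \sum_i al i * be i = 0 & \sum_i be i ^+ 2 = p^-1].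
Proof.
move=> eE on; apply: orthonormal_coef => i j; rewrite -on !eE ip_conn_metric.
rewrite !conn_onD !conn_onZ conn_x !conn_horiz0 !base_ptD !base_ptZ.
rewrite base_pt_fibre !scaler0 !add0r dotvZr dotvC dotvZr dotv_horiz eqxx.
by rewrite !(mulr0, mulr1, addr0) [be j * be i]mulrC.
Qed.

(* The terms in the first derivatives of phi and the second derivatives of phi
   along V cancel. *)
Lemma stability_trace (e : 'I_2 -> 'rV[R]_4) (al be : 'I_2 -> R) :
  (forall i, e i = al i *: xi + be i *: h j2) ->
  (forall i j, ip g x (e i) (e j) = (i == j)%:R) ->
  \sum_i ip g x (curv g x (e i) V V) (e i)
  + \sum_i \sum_j ip g x (connv g (e i) (e j) x) V ^+ 2 =
  - (dird (h j2) (dird (h j2) phi) x * (v1 ^+ 2 + v2 ^+ 2) / (2 * p)).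
Proof.
move=> eE on; have nV := conn_normal0; have nh := conn_horiz0.
have [sa sab sb] := frame_sums eE on.
have kE Y Z T := metric_ip_connv Y Z T Wx.
(* The next four values are the second fundamental form paired with V on the basis xi, h_3. They
   satisfy p b00 + p^-1 b33 = 0, which is the minimality of N at x. *)
have b00 : ip g x (connv g xi xi x) V = v2 * q / (2 * p ^+ 2).
  by rewrite kE (koszul_ffh nV) dphiV.
have b03 : ip g x (connv g xi (h j2) x) V = v1 * q / (2 * p).
  rewrite kE (koszul_fhh (nh _) nV) conn_hV conn_Vh curl31 curl23.
  by move: (P j0 j2) (P j2 j1) => ? ?; field.
have b30 : ip g x (connv g (h j2) xi x) V = v1 * q / (2 * p).
  rewrite kE (koszul_hfh (nh _) nV) conn_hV conn_Vh curl31 curl23.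
  by move: (P j0 j2) (P j2 j1) => ? ?; field.
have b33 : ip g x (connv g (h j2) (h j2) x) V = - (v2 * q) / 2.
  rewrite kE (koszul_hhh (nh _) (nh _) nV) dphi3 dphiV dotv_horiz eqxx.
  by rewrite !mul0r mulr1 addr0 sub0r; field.
pose s00 := ip g x (curv g x xi V V) xi.
pose s33 := ip g x (curv g x (h j2) V V) (h j2).
(* The cross terms are grouped in [s03] and vanish with the sum of al i be i, so no mixed curvature
   component has to be computed. *)
have -> : \sum_i ip g x (curv g x (e i) V V) (e i) = p * s00 + p^-1 * s33.
  pose s03 := ip g x (curv g x xi V V) (h j2)
    + ip g x (curv g x (h j2) V V) xi.
  transitivity (\sum_i (al i ^+ 2 * s00 + al i * be i * s03 + be i ^+ 2 * s33)).
    apply: eq_bigr => i _; rewrite eE curvDl !curvZl ipDl !ipDr !ipZl !ipZr.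
    by rewrite /s00 /s03 /s33; do 4!move: (ip g x _ _) => ?; ring.
  by rewrite !big_split /= -!mulr_suml sa sab sb mul0r addr0.
have -> : \sum_i \sum_j ip g x (connv g (e i) (e j) x) V ^+ 2 =
    2^-1 * q ^+ 2 * (v1 ^+ 2 + v2 ^+ 2) / p ^+ 2.
  transitivity (\sum_i \sum_j (al i * al j * (v2 * q / (2 * p ^+ 2))
      + (al i * be j + be i * al j) * (v1 * q / (2 * p))
      - be i * be j * (v2 * q / 2)) ^+ 2).
    apply: eq_bigr => i _; apply: eq_bigr => j _; congr (_ ^+ 2).
    rewrite !eE connvDl !connvDr !connvZl !connvZr !ipDl !ipZl b00 b03 b30 b33.
    by field.
  move: sa sab sb; rewrite !big_ord_recl !big_ord0 !addr0.
  set a0 := al _; set a1 := al _; set c0 := be _; set c1 := be _.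
  move=> sa sab sb.
  (* A polynomial identity that writes the squared norm of a symmetric bilinear form through the
     three frame sums; the sums p, 0 and 1/p are then substituted. *)
  rewrite [LHS](_ : _ = (a0 ^+ 2 + a1 ^+ 2) ^+ 2 * (v2 * q / (2 * p ^+ 2)) ^+ 2
    + 2 * ((a0 ^+ 2 + a1 ^+ 2) * (c0 ^+ 2 + c1 ^+ 2)
           + (a0 * c0 + a1 * c1) ^+ 2) * (v1 * q / (2 * p)) ^+ 2
    + (c0 ^+ 2 + c1 ^+ 2) ^+ 2 * (v2 * q / 2) ^+ 2
    + (a0 * c0 + a1 * c1) * (4 * (a0 ^+ 2 + a1 ^+ 2) * (v2 * q / (2 * p ^+ 2))
        * (v1 * q / (2 * p))
      - 2 * (a0 * c0 + a1 * c1) * (v2 * q / (2 * p ^+ 2)) * (v2 * q / 2)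
      - 4 * (c0 ^+ 2 + c1 ^+ 2) * (v1 * q / (2 * p)) * (v2 * q / 2))).
    by rewrite sa sab sb; field.
  by field.
rewrite /s00 /s33 curv_fibre curv_axis.
do 2!move: (dird _ (dird _ _) _) => ?.
by field.
Qed.

End OnAxis.

End AtPoint.

(** * Arbitrary parametrised surfaces lying over the axis *)

Section AxisSurface.
Variables (F : 'rV[R]_2 -> 'rV[R]_4) (w : 'rV[R]_2).
Local Notation x := (F w).
Local Notation P i j := (pd (lift ord0 i) (fun u => eta u 0 (lift ord0 j)) x).
Hypothesis Wx : W x.
Hypothesis F_axis :
  \forall y \near w, F y 0 (lift ord0 j0) = 0 /\ F y 0 (lift ord0 j1) = 0.
Hypotheses (phi_1 : pd (lift ord0 j0) phi x = 0)
  (phi_3 : pd (lift ord0 j2) phi x = 0).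
Hypotheses (curl12 : P j0 j1 = P j1 j0)
  (curl31 : P j2 j0 = P j0 j2 + pd (lift ord0 j1) phi x)
  (curl23 : P j1 j2 = P j2 j1).
Hypothesis phi_33 : pd (lift ord0 j2) (pd (lift ord0 j2) phi) x < 0.

(** At x this is the span of xi and h_3. As a fixed coordinate subspace it contains every first and
    second derivative of a map F that stays over the axis. *)
Definition axial (Y : 'rV[R]_4) : Prop :=
  Y 0 (lift ord0 j0) = 0 /\ Y 0 (lift ord0 j1) = 0.

Lemma axial_decomp Y : axial Y ->
  Y = conn_on Y x *: fibre_vec R + Y 0 (lift ord0 j2) *: horiz x j2.
Proof.
move=> [Y0 Y1]; rewrite {1}(horiz_decomp Wx Y) !big_ord_recl big_ord0 Y0 Y1.
by rewrite !scale0r !add0r addr0.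
Qed.

Let F_axis0 (i : 'I_4) : i = lift ord0 j0 \/ i = lift ord0 j1 ->
  \forall y \near w, F y 0 i = 0.
Proof.
by case=> ->; apply: filterS F_axis => y [].
Qed.

Let pd_zero n (f : 'rV[R]_n.+1 -> R) (z : 'rV[R]_n.+1) a :
  (\forall y \near z, f y = 0) -> pd a f z = 0.
Proof. by move=> f0; rewrite (pd_near a f0) pd_cst. Qed.

Let pd2_zero n (f : 'rV[R]_n.+1 -> R) (z : 'rV[R]_n.+1) a b :
  (\forall y \near z, f y = 0) -> pd a (pd b f) z = 0.
Proof.
move=> f0; apply: pd_zero; apply: filterS (nbhs_interior f0) => y.
by move=> /pd_zero.
Qed.

Lemma axial_push X : axial (push F w X).
Proof.
split; rewrite /push summxE big1// => a _; rewrite !mxE.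
  by rewrite pd_zero ?mulr0//; apply: F_axis0; left.
by rewrite pd_zero ?mulr0//; apply: F_axis0; right.
Qed.

Lemma axial_hess a b : axial (hess F w a b).
Proof.
split; rewrite mxE; apply: pd2_zero; apply: F_axis0; [by left|by right].
Qed.

Lemma axial_ip V Y : axial Y -> ip g x xi V = 0 ->
  ip g x (horiz x j2) V = 0 -> ip g x Y V = 0.
Proof.
by move=> aY V0 V3; rewrite (axial_decomp aY) ipDl !ipZl V0 V3 !mulr0 addr0.
Qed.

Lemma axis_surface_negative : negative_stability_op g F w.
Proof.
move=> e on V nV Vn0; have px := phi_gt0 Wx; have px0 := phi_neq0 Wx.
pose al i := conn_on (push F w (e i)) x.
pose be i := push F w (e i) 0 (lift ord0 j2).
have eE i : push F w (e i) = al i *: xi + be i *: horiz x j2.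
  exact: axial_decomp (axial_push _).
have eV i : al i * ip g x xi V + be i * ip g x (horiz x j2) V = 0.
  by rewrite -!ipZl -ipDl -eE (ip_push_normal (metric_sym _) nV).
have [sa sab sb] := frame_sums Wx eE on.
move: eV; set A := ip g x xi V; set B := ip g x (horiz x j2) V => eV.
(* V is orthogonal to each frame vector. Combining these relations with weights al i isolates <xi,
   V> because the sums are p and 0; the weights be i isolate <h_3, V> in the same way. *)
have V0 : A = 0.
  apply: (mulfI px0); rewrite mulr0.
  transitivity (\sum_i (al i ^+ 2 * A + al i * be i * B)).
    by rewrite big_split /= -!mulr_suml sa sab mul0r addr0.
  apply: big1 => i _; rewrite -[RHS](mulr0 (al i)) -(eV i).
  by rewrite mulrDr expr2 !mulrA.
have V3 : B = 0.
  have pV0 : (phi x)^-1 != 0 by rewrite invr_eq0.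
  apply: (mulfI pV0); rewrite mulr0.
  transitivity (\sum_i (al i * be i * A + be i ^+ 2 * B)).
    by rewrite big_split /= -!mulr_suml sb sab mul0r add0r.
  apply: big1 => i _; rewrite -[RHS](mulr0 (be i)) -(eV i).
  by rewrite mulrDr expr2 !mulrA [be i * al i]mulrC.
have cV : conn_on V x = 0.
  have := V0; rewrite /A ip_conn_metric conn_on_fibre// mul1r base_pt_fibre.
  rewrite dotvC dotv0r mulr0 addr0 => /eqP.
  by rewrite mulf_eq0 invr_eq0 (negPf px0) => /eqP.
have V2 : V 0 (lift ord0 j2) = 0.
  have := V3; rewrite /B ip_conn_metric cV mulr0 mulr0 add0r base_pt_horiz.
  rewrite dotvC dotv_basis mxE => /eqP.
  by rewrite mulf_eq0 (negPf px0) => /eqP.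
pose v1 := V 0 (lift ord0 j0); pose v2 := V 0 (lift ord0 j1).
have VE : V = v1 *: horiz x j0 + v2 *: horiz x j1.
  rewrite {1}(horiz_decomp Wx V) !big_ord_recl big_ord0 V2 cV.
  by rewrite !scale0r add0r !addr0.
have v_gt0 : 0 < v1 ^+ 2 + v2 ^+ 2.
  rewrite lt0r addr_ge0 ?sqr_ge0// andbT paddr_eq0 ?sqr_ge0// !sqrf_eq0.
  apply: contra Vn0 => /andP[/eqP v10 /eqP v20].
  by rewrite VE v10 v20 !scale0r addr0.
rewrite (ip_simons_op (metric_sym _) nV) => [|a b]; last first.
  exact: axial_ip (axial_hess _ _) V0 V3.
rewrite -opprD /normal_curv_form.
rewrite (stability_trace Wx phi_1 erefl phi_3 curl12 curl31 curl23 VE eE on).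
rewrite opprK pmulr_llt0 ?invr_gt0 ?mulr_gt0// pmulr_llt0//.
rewrite (_ : dird _ _ _ = dird (horiz x j2) (pd (lift ord0 j2) phi) x).
  by rewrite dird_horiz//; exact: (pd_invariant oW).
apply: dird_near; apply: (near_open oW Wx) => y Wy.
by rewrite dird_horiz.
Qed.

End AxisSurface.

End GibbonsHawkingMetric.

(** * Coordinate functions and square roots *)

Section Coordinates.
Variable R : realType.

Lemma continuous_rV (T : topologicalType) n (F : T -> 'rV[R]_n) x :
  (forall j, {for x, continuous (fun y => F y 0 j)}) -> {for x, continuous F}.
Proof.
move=> Fj A [P FP PA].
apply: (filterS (P := fun y => forall j, P 0 j (F y 0 j))).
  by move=> y Py; apply: PA => i j; rewrite (ord1 i); exact: Py.
by apply: filter_forall => j; exact: (Fj j _ (FP 0 j)).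
Qed.

Lemma derivable_coord n (x v : 'rV[R]_n.+1) j :
  derivable (fun y : 'rV[R]_n.+1 => y 0 j) x v.
Proof.
have /derivable_mxP := @derivable_id R 'rV[R]_n.+1 x v.
by apply.
Qed.

Lemma pd_coord n a (x : 'rV[R]_n.+1) j :
  pd a (fun y : 'rV[R]_n.+1 => y 0 j) x = (a == j)%:R.
Proof.
have := derive_mx (@derivable_id R 'rV[R]_n.+1 x (basis_vec R a)).
rewrite derive_id => /matrixP/(_ 0 j); rewrite !mxE eqxx eq_sym => ->.
by [].
Qed.

Lemma pdable_coord n (x : 'rV[R]_n.+1) j :
  pdable (fun y : 'rV[R]_n.+1 => y 0 j) x.
Proof. by move=> a; exact: derivable_coord. Qed.

Lemma C2on_coord n (W : set 'rV[R]_n.+1) j :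
  C2on W (fun y : 'rV[R]_n.+1 => y 0 j).
Proof.
split=> [u|a u] _; first exact: pdable_coord.
rewrite (_ : pd a _ = fun=> (a == j)%:R); first exact: pdable_cst.
by apply/funext => y; rewrite pd_coord.
Qed.

End Coordinates.

Section SquareRoot.
Variables (R : realType) (n : nat).
Implicit Types (f : 'rV[R]_n.+1 -> R) (x Y Z : 'rV[R]_n.+1).

(** The one-variable chain rule is applied to f restricted to the line through x with direction v;
    [lineE] identifies the two derivatives. *)
Lemma is_derive_sqrt f x v : 0 < f x -> derivable f x v ->
  is_derive x v (fun y => Num.sqrt (f y)) ((2 * Num.sqrt (f x))^-1 * 'D_v f x).
Proof.
move=> f0 df; pose k h : R := f (h *: v + x).
have k0 : k 0 = f x by rewrite /k scale0r add0r.
have lineE (F : 'rV[R]_n.+1 -> R) :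
    'D_v F x = 'D_1 (fun h : R => F (h *: v + x)) 0.
  rewrite /derive; set l1 := fun h => _; set l2 := fun h => _.
  suff -> : l1 = l2 by [].
  by apply/funext => h; rewrite /l1 /l2 /= addr0 scale0r add0r [_%:A]mulr1.
have dk : is_derive (0 : R) 1 k ('D_v f x).
  have -> : 'D_v f x = 'D_1 k 0 by exact: lineE.
  by apply: derivableP; exact: ((derivable1P f x v).1 df).
have ds : is_derive (k 0) 1 (@Num.sqrt R) (2 * Num.sqrt (f x))^-1.
  by rewrite k0; exact: is_derive1_sqrt.
have [dsk dskE] := is_derive1_comp ds dk.
have dv : derivable (fun y => Num.sqrt (f y)) x v.
  exact: (derivable1P (fun y => Num.sqrt (f y)) x v).2.
rewrite -dskE.
have <- : 'D_v (fun y => Num.sqrt (f y)) x = 'D_1 (Num.sqrt \o k) 0.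
  exact: lineE.
exact: derivableP.
Qed.

Lemma pdable_sqrt f x : 0 < f x -> pdable f x ->
  pdable (fun y => Num.sqrt (f y)) x.
Proof. by move=> f0 df a; have [] := is_derive_sqrt f0 (df a). Qed.

Lemma dird_sqrt Y f x : 0 < f x -> pdable f x ->
  dird Y (fun y => Num.sqrt (f y)) x = (2 * Num.sqrt (f x))^-1 * dird Y f x.
Proof.
move=> f0 df; rewrite mulr_sumr; apply: eq_bigr => a _.
by have [_] := is_derive_sqrt f0 (df a); rewrite /pd => ->; ring.
Qed.

Variable W : set 'rV[R]_n.+1.
Hypothesis oW : open W.

Lemma C2on_sqrt f : (forall u, W u -> 0 < f u) -> C2on W f ->
  C2on W (fun y => Num.sqrt (f y)).
Proof.
move=> f0 Cf; have df u := C2on_pdable Cf (u := u).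
split=> [u|a u] Wu; first by apply: pdable_sqrt; [exact: f0|exact: df].
have ds : pdable (fun y => Num.sqrt (f y)) u.
  by apply: pdable_sqrt; [exact: f0|exact: df].
have s0 : 2 * Num.sqrt (f u) != 0.
  by rewrite mulf_neq0// gt_eqF// sqrtr_gt0 f0.
have := pdableM (pdableV s0 (pdableZ (c := 2) ds)) (C2on_pd Cf (a := a) Wu).
move/pdable_near; apply; apply: (near_open oW Wu) => y Wy.
by rewrite -!dird_basis (dird_sqrt _ (f0 y Wy) (df y Wy)).
Qed.

Lemma dird2_sqrt Y Z f x : (forall u, W u -> 0 < f u) -> C2on W f -> W x ->
  dird Y (dird Z (fun y => Num.sqrt (f y))) x =
  dird Y (dird Z f) x / (2 * Num.sqrt (f x))
  - dird Y f x * dird Z f x / (4 * Num.sqrt (f x) ^+ 3).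
Proof.
move=> f0 Cf Wx; have df u := C2on_pdable Cf (u := u).
have s0 : Num.sqrt (f x) != 0 by rewrite gt_eqF// sqrtr_gt0 f0.
have s20 : 2 * Num.sqrt (f x) != 0 by rewrite mulf_neq0.
have ds := pdable_sqrt (f0 x Wx) (df x Wx).
have ds2 : pdable (fun y => 2 * Num.sqrt (f y)) x by exact: pdableZ.
have dV := pdableV s20 ds2.
have dZf := C2on_dird (Y := Z) Cf Wx.
have -> : dird Y (dird Z (fun y => Num.sqrt (f y))) x =
    dird Y (fun y => (2 * Num.sqrt (f y))^-1 * dird Z f y) x.
  apply: dird_near; apply: (near_open oW Wx) => y Wy.
  by apply: dird_sqrt; [exact: f0|exact: df].
rewrite (dirdM _ dV dZf) (dirdV _ s20 ds2) (dirdZ _ _ ds).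
rewrite (dird_sqrt _ (f0 x Wx) (df x Wx)).
move: (Num.sqrt (f x)) s0 => s s0; do 3!move: (dird _ _ x) => ?.
by field.
Qed.

End SquareRoot.

(** * Derivatives of the poles and of the potential *)

Section Potential.
Variables (R : realType) (n : nat) (W : set 'rV[R]_n.+1).
Hypothesis oW : open W.
Implicit Types (c x Y : 'rV[R]_n.+1).

Lemma dotv_gt0 x : x != 0 -> 0 < dotv x x.
Proof.
have sq i : true -> 0 <= x 0 i * x 0 i by rewrite -expr2 sqr_ge0.
move=> x0; rewrite lt0r sumr_ge0 ?andbT//; apply: contra x0 => /eqP.
move/(psumr_eq0P sq) => xi; apply/eqP/rowP => i; rewrite mxE.
by have /eqP := xi i isT; rewrite mulf_eq0 orbb => /eqP.
Qed.

Lemma eucl_norm_gt0 x : x != 0 -> 0 < eucl_norm x.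
Proof. by move=> x0; rewrite sqrtr_gt0 dotv_gt0. Qed.

Let sqd c x : R := dotv (x - c) (x - c).

Let sqdE c : sqd c = fun x => \sum_j (x 0 j + - c 0 j) * (x 0 j + - c 0 j).
Proof.
by apply/funext => x; apply: eq_bigr => j _; rewrite !mxE.
Qed.

Let C2on_shift c j : C2on W (fun x => x 0 j + - c 0 j).
Proof. by apply: C2onD => //; [exact: C2on_coord|exact: C2on_cst]. Qed.

Let C2on_sqd c : C2on W (sqd c).
Proof. by rewrite sqdE; apply: C2on_sum => // j; apply: C2onM. Qed.

Let pd_shift a c j x : pd a (fun y => y 0 j + - c 0 j) x = (a == j)%:R.
Proof.
rewrite pdD; [|exact: pdable_coord|exact: pdable_cst].
by rewrite pd_coord pd_cst addr0.
Qed.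

Let pdable_shift c j x : pdable (fun y => y 0 j + - c 0 j) x.
Proof. by apply: pdableD; [exact: pdable_coord|exact: pdable_cst]. Qed.

Let pd_sqd a c x : pd a (sqd c) x = 2 * (x 0 a - c 0 a).
Proof.
rewrite sqdE pd_sum => [|i]; last exact: pdableM.
rewrite (bigD1 a)//= big1 ?addr0 => [|i ia].
  by rewrite pdM// pd_shift eqxx mulr1 mulrDl mul1r.
by rewrite pdM// pd_shift eq_sym (negPf ia) !mulr0 addr0.
Qed.

Let pd2_sqd a c x : pd a (pd a (sqd c)) x = 2.
Proof.
rewrite (_ : pd a (sqd c) = fun y => 2 * (y 0 a + - c 0 a)); last first.
  by apply/funext => y; rewrite pd_sqd.
by rewrite -dird_basis dirdZ// dird_basis pd_shift eqxx mulr1.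
Qed.

Section Pole.
Variable c : 'rV[R]_n.+1.
Hypothesis Wc : forall x, W x -> x != c.

Let sqd_gt0 x : W x -> 0 < sqd c x.
Proof. by move=> Wx; apply: dotv_gt0; rewrite subr_eq0; exact: Wc. Qed.

Let norm2_neq0 x : W x -> 2 * Num.sqrt (sqd c x) != 0.
Proof. by move=> Wx; rewrite mulf_neq0// gt_eqF// sqrtr_gt0 sqd_gt0. Qed.

Let C2on_norm2 : C2on W (fun x => 2 * Num.sqrt (sqd c x)).
Proof.
apply: C2onM => //; first exact: C2on_cst.
by apply: C2on_sqrt => //; exact: sqd_gt0.
Qed.

Lemma C2on_pole : C2on W (fun x => (2 * eucl_norm (x - c))^-1).
Proof. exact: (C2onV oW norm2_neq0 C2on_norm2). Qed.

Let dir_sqd_term x a : W x ->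
  dird (basis_vec R a) (fun x => 2 * Num.sqrt (sqd c x)) x =
  2 * (x 0 a - c 0 a) / eucl_norm (x - c).
Proof.
move=> Wx; have ds := C2on_pdable (C2on_sqd c) Wx.
rewrite (dirdZ _ _ (pdable_sqrt (sqd_gt0 Wx) ds)) (dird_sqrt _ (sqd_gt0 Wx) ds).
have := norm2_neq0 Wx; rewrite dird_basis pd_sqd /eucl_norm -/(sqd c x).
by move: (Num.sqrt _) => s s0; field; apply: contra s0 => /eqP->; rewrite mulr0.
Qed.

Lemma pd_pole a x : W x -> pd a (fun x => (2 * eucl_norm (x - c))^-1) x =
  - (x 0 a - c 0 a) / (2 * eucl_norm (x - c) ^+ 3).
Proof.
move=> Wx; rewrite -dird_basis.
rewrite (dirdV _ (norm2_neq0 Wx) (C2on_pdable C2on_norm2 Wx)) dir_sqd_term//.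
have := norm2_neq0 Wx; rewrite /eucl_norm -/(sqd c x).
by move: (Num.sqrt _) => s s0; field; apply: contra s0 => /eqP->; rewrite mulr0.
Qed.

Lemma pd2_pole a x : W x ->
  pd a (pd a (fun x => (2 * eucl_norm (x - c))^-1)) x =
  (3 * (x 0 a - c 0 a) ^+ 2 - eucl_norm (x - c) ^+ 2)
    / (2 * eucl_norm (x - c) ^+ 5).
Proof.
move=> Wx; pose b := basis_vec R a.
have ds := C2on_pdable (C2on_sqd c) Wx.
have dirE f : pd a f = dird b f by apply/funext => y; rewrite dird_basis.
rewrite !dirE (dird2V oW _ _ norm2_neq0 C2on_norm2 Wx) dir_sqd_term//.
have Cs := C2on_sqrt oW sqd_gt0 (C2on_sqd c).
rewrite (dird2M oW _ _ (C2on_cst _ 2) Cs Wx) !dird_cst.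
have -> : dird b (dird b (fun=> 2 : R)) x = 0.
  rewrite -(dird_cst b 0 x); apply: dird_near.
  by apply: (near_open oW Wx) => u _; rewrite dird_cst.
rewrite (dird2_sqrt oW _ _ sqd_gt0 (C2on_sqd c) Wx) -!dirE pd2_sqd pd_sqd.
have := norm2_neq0 Wx; rewrite /eucl_norm -/(sqd c x).
by move: (Num.sqrt _) => s s0; field; apply: contra s0 => /eqP->; rewrite mulr0.
Qed.

End Pole.

End Potential.

Section GibbonsHawkingPotential.
Variables (R : realType) (m : R) (k : nat) (p : 'I_k -> 'rV[R]_3).
Variable W : set 'rV[R]_3.
Hypotheses (oW : open W) (Wreg : W `<=` regular_set p).

Let Wp i x : W x -> x != p i. Proof. by move=> /Wreg; exact. Qed.

Let Cpole i : C2on W (fun x => (2 * eucl_norm (x - p i))^-1).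
Proof. exact: (C2on_pole oW (@Wp i)). Qed.

Lemma C2on_gh_potential : C2on W (gh_potential m p).
Proof.
apply: C2onD => //; first exact: C2on_cst.
exact: (C2on_sum oW).
Qed.

(** Strictness comes from the first pole, so the case m = 0 is covered. *)
Lemma gh_potential_gt0 x : 0 <= m -> (0 < k)%N -> W x -> 0 < gh_potential m p x.
Proof.
move=> m0; case: k p Wp => // k' p' Wp' _ Wx.
rewrite /gh_potential big_ord_recl addrCA ltr_pwDl//; last first.
  rewrite addr_ge0// sumr_ge0// => i _.
  by rewrite invr_ge0 mulr_ge0// sqrtr_ge0.
by rewrite invr_gt0 mulr_gt0// eucl_norm_gt0// subr_eq0 Wp'.
Qed.

Lemma pd_gh_potential a x : W x -> pd a (gh_potential m p) x =
  \sum_i - (x 0 a - p i 0 a) / (2 * eucl_norm (x - p i) ^+ 3).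
Proof.
move=> Wx; have dp i := C2on_pdable (Cpole i) Wx.
rewrite /gh_potential pdD; [|exact: pdable_cst|exact: pdable_sum].
rewrite pd_cst add0r (pd_sum _ dp).
by apply: eq_bigr => i _; exact: (pd_pole oW (@Wp i)).
Qed.

Lemma pd2_gh_potential a x : W x -> pd a (pd a (gh_potential m p)) x =
  \sum_i (3 * (x 0 a - p i 0 a) ^+ 2 - eucl_norm (x - p i) ^+ 2)
    / (2 * eucl_norm (x - p i) ^+ 5).
Proof.
move=> Wx; have dp i := C2on_pd (Cpole i) (a := a) Wx.
rewrite (@pd_near _ _ _ _
    (fun y => \sum_i pd a (fun z => (2 * eucl_norm (z - p i))^-1) y)).
  rewrite (pd_sum _ dp); apply: eq_bigr => i _.
  exact: (pd2_pole oW (@Wp i)).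
apply: (near_open oW Wx) => y Wy; have dpy i := C2on_pdable (Cpole i) Wy.
rewrite /gh_potential pdD; [|exact: pdable_cst|exact: pdable_sum].
by rewrite pd_cst add0r (pd_sum _ dpy).
Qed.

End GibbonsHawkingPotential.

(** * Pulling functions on R^3 back to bundle coordinates *)

Section PullbackToBundle.
Variable R : realType.
Implicit Types (f : 'rV[R]_3 -> R) (u : 'rV[R]_4) (D : set 'rV[R]_3).

Lemma base_pt_shift h i u :
  base_pt (h *: basis_vec R (lift ord0 i) + u) = h *: basis_vec R i + base_pt u.
Proof. by rewrite base_ptD base_ptZ base_pt_basis. Qed.

Lemma pd_base_pt i f u :
  pd (lift ord0 i) (f \o @base_pt R) u = pd i f (base_pt u).
Proof.
rewrite /pd /derive; set l1 := fun h => _; set l2 := fun h => _.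
suff -> : l1 = l2 by [].
by apply/funext => h; rewrite /l1 /l2 /= base_pt_shift.
Qed.

Lemma base_pt_translate u s : base_pt (u + s *: fibre_vec R) = base_pt u.
Proof. by rewrite base_ptD base_ptZ base_pt_fibre scaler0 addr0. Qed.

Lemma invariant_base_pt W f : invariant_on W (fibre_vec R) (f \o @base_pt R).
Proof. by move=> u s _; rewrite /= base_pt_translate. Qed.

Lemma pdable_base_pt f u : pdable f (base_pt u) -> pdable (f \o @base_pt R) u.
Proof.
move=> df a; case: (unliftP ord0 a) => [i ->|->].
  have := df i; rewrite /derivable; set l1 := fun h => _; set l2 := fun h => _.
  suff -> : l1 = l2 by [].
  by apply/funext => h; rewrite /l1 /l2 /= base_pt_shift.
(* Along the fibre the pullback is constant, so its difference quotient is identically zero. *)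
rewrite /derivable (_ : (fun h => _) = fun=> 0); first exact: is_cvg_cst.
apply/funext => h /=; rewrite [_ + u]addrC -/(fibre_vec R) base_pt_translate.
by rewrite subrr scaler0.
Qed.

Lemma C2on_base_pt D f : C2on D f ->
  C2on (@base_pt R @^-1` D) (f \o @base_pt R).
Proof.
move=> [df ddf]; split=> [u Du|a u Du].
  by apply: pdable_base_pt; exact: df.
case: (unliftP ord0 a) => [i ->|->].
  rewrite (_ : pd _ _ = pd i f \o @base_pt R); last first.
    by apply/funext => y; rewrite pd_base_pt.
  by apply: pdable_base_pt; exact: ddf.
rewrite (_ : pd _ _ = fun=> 0); first exact: pdable_cst.
apply/funext => y.
exact: (derive_invariant (W := setT) (@invariant_base_pt setT f)).
Qed.

Lemma open_base_pt D : open D -> open (@base_pt R @^-1` D).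
Proof.
move=> oD; apply: open_comp oD => u _; apply: continuous_rV => j.
rewrite (_ : (fun y => _) = fun y : 'rV[R]_4 => y 0 (lift ord0 j)).
  exact: coord_continuous.
by apply/funext => y; rewrite mxE.
Qed.

End PullbackToBundle.

Section CrossProduct.
Variable R : realType.

Lemma cross_prodE (v w : 'rV[R]_3) :
  [/\ cross_prod v w 0 j0 = v 0 j1 * w 0 j2 - v 0 j2 * w 0 j1,
      cross_prod v w 0 j1 = v 0 j2 * w 0 j0 - v 0 j0 * w 0 j2 &
      cross_prod v w 0 j2 = v 0 j0 * w 0 j1 - v 0 j1 * w 0 j0].
Proof.
have e0 : inord 0 = j0 by apply: val_inj; rewrite /= inordK.
have e1 : inord 1 = j1 by apply: val_inj; rewrite /= inordK.
have e2 : inord 2 = j2 by apply: val_inj; rewrite /= inordK.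
by split; rewrite mxE /= ?e0 ?e1 ?e2.
Qed.

Lemma dotv3 (v w : 'rV[R]_3) :
  dotv v w = v 0 j0 * w 0 j0 + v 0 j1 * w 0 j1 + v 0 j2 * w 0 j2.
Proof. by rewrite /dotv !big_ord_recl big_ord0 addr0 addrA. Qed.

End CrossProduct.

(** * Smoothness of constants and shifted coordinates *)

Section SmoothFunctions.
Variables (R : realType) (n : nat) (W : set 'rV[R]_n.+1).

Lemma smooth_on_cst (c : R) : smooth_on W (fun=> c).
Proof.
have cont (d : R) (x : 'rV[R]_n.+1) : {for x, continuous (fun=> d : R)}.
  exact: cst_continuous.
move=> k; elim: k c => [|k IHk] c; first by split=> [x _|].
split=> [x _|i]; first exact: cont.
split=> [x _|]; first exact: derivable_cst.
rewrite (_ : pd i _ = fun=> 0); first exact: IHk.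
by apply/funext => y; rewrite pd_cst.
Qed.

Lemma smooth_on_coordD (c : R) j : smooth_on W (fun y => y 0 j + c).
Proof.
have cont x : {for x, continuous (fun y : 'rV[R]_n.+1 => y 0 j + c)}.
  have cj : {for x, continuous (fun y : 'rV[R]_n.+1 => y 0 j)}.
    exact: coord_continuous.
  exact: (cvgD cj (cvg_cst c)).
case=> [|k]; first by split=> [x _|].
split=> [x _|i]; first exact: cont.
split=> [x _|].
  by apply: derivableD; [exact: derivable_coord|exact: derivable_cst].
rewrite (_ : pd i _ = fun=> (i == j)%:R); first exact: smooth_on_cst.
apply/funext => y; rewrite pdD; [|exact: pdable_coord|exact: pdable_cst].
by rewrite pd_coord pd_cst addr0.
Qed.

End SmoothFunctions.

(** * From the axioms of the space to the local computation *)

Section AxisPoint.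
Variables (R : realType) (m : R) (k : nat) (p : 'I_k -> 'rV[R]_3).
Variables (X : gh_space m p) (c : triv X).
Hypotheses (hm : 0 <= m) (k_gt0 : (0 < k)%N).

Local Notation phi := (gh_potential m p \o @base_pt R).
Local Notation eta := (triv_conn c).
Local Notation W := (@base_pt R @^-1` triv_dom c).

Lemma conn_curl u i j : W u ->
  pd (lift ord0 i) (fun y => eta y 0 (lift ord0 j)) u
  - pd (lift ord0 j) (fun y => eta y 0 (lift ord0 i)) u =
  star_d (gh_potential m p) (base_pt u) (basis_vec R i) (basis_vec R j).
Proof.
move=> Wu.
have := conn_curvature (basis_vec R (lift ord0 i))
  (basis_vec R (lift ord0 j)) Wu.
have dE l : (fun y => dotv (eta y) (basis_vec R l)) = (fun y => eta y 0 l).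
  by apply/funext => y; rewrite dotv_basis.
by rewrite !base_pt_basis /ext_d !dE.
Qed.

Lemma C2on_smooth n (D : set 'rV[R]_n.+1) f : smooth_on D f -> C2on D f.
Proof.
move=> sf; have [_ df] := sf 2; split=> [u Du a|a u Du b].
  by have [+ _] := df a; apply.
by have [_ [_ ddf]] := df a; have [+ _] := ddf b; apply.
Qed.

(** In one trivialisation the axioms of [gh_space] supply the abstract hypotheses, and the
    conditions on phi are moved down to R^3. *)
Lemma gh_axis_negative (F : 'rV[R]_2 -> 'rV[R]_4) (w : 'rV[R]_2) :
  triv_dom c (base_pt (F w)) ->
  (\forall y \near w, F y 0 (lift ord0 j0) = 0 /\ F y 0 (lift ord0 j1) = 0) ->
  pd j0 (gh_potential m p) (base_pt (F w)) = 0 ->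
  pd j2 (gh_potential m p) (base_pt (F w)) = 0 ->
  pd j2 (pd j2 (gh_potential m p)) (base_pt (F w)) < 0 ->
  negative_stability_op (gh_metric m p eta) F w.
Proof.
move=> Dw F_axis phi_1 phi_3 phi_33.
have oD : open (triv_dom c) by exact: triv_open.
have oW : open W by exact: open_base_pt.
have regD : triv_dom c `<=` regular_set p by exact: triv_regular.
have phi_gt0 u : W u -> 0 < phi u.
  by move=> Wu; exact: (gh_potential_gt0 regD).
have eta_fibre u : W u -> eta u 0 ord0 = 1.
  by move=> Wu; have := conn_fibre Wu; rewrite dotv_basis.
have C2phi : C2on W phi.
  by apply: C2on_base_pt; exact: C2on_gh_potential.
have C2eta i : C2on W (fun u => eta u 0 i).
  by apply: C2on_smooth; exact: conn_smooth.
have eta_inv i : invariant_on W (fibre_vec R) (fun u => eta u 0 i).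
  by move=> u s Wu; rewrite conn_invariant.
have curl i j := conn_curl i j Dw.
(* Since d phi = d_2 phi dx_2 at this point, only the second component of the cross product counts.
   It is 0 for the index pairs (1,2) and (2,3), and 1 for (3,1). *)
have star i j : star_d (gh_potential m p) (base_pt (F w)) (basis_vec R i)
    (basis_vec R j) = pd j1 (gh_potential m p) (base_pt (F w))
    * cross_prod (basis_vec R i) (basis_vec R j) 0 j1.
  rewrite /star_d dotv3 !mxE.
  by rewrite phi_1 phi_3 !mul0r add0r addr0.
apply: (axis_surface_negative oW phi_gt0 eta_fibre C2phi C2eta
  (@invariant_base_pt R W (gh_potential m p)) eta_inv Dw F_axis).
- by rewrite pd_base_pt.
- by rewrite pd_base_pt.
- have := curl j0 j1; rewrite star.
  have [_ -> _] := cross_prodE (basis_vec R j0) (basis_vec R j1).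
  by rewrite !mxE /= !(mulr0, mul0r) subrr mulr0 => /subr0_eq.
- have := curl j2 j0; rewrite star.
  have [_ -> _] := cross_prodE (basis_vec R j2) (basis_vec R j0).
  rewrite !mxE /= !(mulr0, mul0r) subr0 !mulr1 => /eqP.
  by rewrite subr_eq addrC pd_base_pt => /eqP.
- have := curl j1 j2; rewrite star.
  have [_ -> _] := cross_prodE (basis_vec R j1) (basis_vec R j2).
  by rewrite !mxE /= !(mulr0, mul0r) subrr mulr0 => /subr0_eq.
- rewrite (_ : pd _ phi = pd j2 (gh_potential m p) \o @base_pt R).
    by rewrite pd_base_pt.
  by apply/funext => y; rewrite pd_base_pt.
Qed.

End AxisPoint.

(** * The potential of the three given points at the origin *)

Section ThreePoints.
Variables (R : realType) (m a e : R).
Hypotheses (hm : 0 <= m) (e_gt0 : 0 < e) (ltea : 2 * e < a).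

Local Notation p := (three_points a e).

Let a_gt0 : 0 < a. Proof. by apply: lt_trans ltea; rewrite mulr_gt0. Qed.

Let p0 : p j0 = point3 0 0 a. Proof. by []. Qed.
Let p1 : p j1 = point3 0 0 (- a). Proof. by []. Qed.
Let p2 : p j2 = point3 0 e 0. Proof. by []. Qed.

Lemma eucl_norm_point3 (s t r : R) :
  eucl_norm (0 - point3 s t r) = Num.sqrt (s ^+ 2 + t ^+ 2 + r ^+ 2).
Proof. by rewrite /eucl_norm dotv3 !mxE /=; congr Num.sqrt; ring. Qed.

Let norm0 : eucl_norm (0 - p j0) = a.
Proof.
by rewrite p0 eucl_norm_point3 expr0n !add0r sqrtr_sqr gtr0_norm.
Qed.

Let norm1 : eucl_norm (0 - p j1) = a.
Proof.
by rewrite p1 eucl_norm_point3 expr0n !add0r sqrtr_sqr normrN gtr0_norm.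
Qed.

Let norm2 : eucl_norm (0 - p j2) = e.
Proof.
by rewrite p2 eucl_norm_point3 expr0n add0r addr0 sqrtr_sqr gtr0_norm.
Qed.

Let sum3 (f : 'I_3 -> R) : \sum_i f i = f j0 + f j1 + f j2.
Proof. by rewrite !big_ord_recl big_ord0 addr0 addrA. Qed.

Variable D : set 'rV[R]_3.
Hypotheses (oD : open D) (regD : D `<=` regular_set p) (D0 : D 0).

Lemma pd1_three_points : pd j0 (gh_potential m p) 0 = 0.
Proof.
(* All three points lie in the plane x_1 = 0. *)
rewrite (pd_gh_potential m oD regD j0 D0) big1// => i _.
suff -> : p i 0 j0 = 0 by rewrite mxE subrr oppr0 mul0r.
by rewrite /p; case: i => [[|[|[|]]]] //= ?; rewrite mxE.
Qed.

(** The contributions of p_1 and p_2 cancel by reflection, and p_3 lies in the plane x_3 = 0. *)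
Lemma pd3_three_points : pd j2 (gh_potential m p) 0 = 0.
Proof.
rewrite (pd_gh_potential m oD regD j2 D0) sum3 norm0 norm1 norm2 p0 p1 p2.
have a0 := lt0r_neq0 a_gt0; have e0 := lt0r_neq0 e_gt0.
by rewrite !mxE /=; field; rewrite a0 e0.
Qed.

Lemma pd33_three_points : pd j2 (pd j2 (gh_potential m p)) 0 < 0.
Proof.
rewrite (pd2_gh_potential m oD regD j2 D0) sum3 norm0 norm1 norm2 p0 p1 p2.
have a0 := lt0r_neq0 a_gt0; have e0 := lt0r_neq0 e_gt0.
rewrite !mxE /=.
rewrite [X in X < 0](_ : _ = (4 * e ^+ 3 - a ^+ 3) / (2 * a ^+ 3 * e ^+ 3)).
  rewrite pmulr_llt0 ?invr_gt0 ?mulr_gt0 ?exprn_gt0// subr_lt0.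
  (* The sharp condition is 4 e^3 < a^3. The factor 2 is a convenient choice above the cube root of
     4: it gives 8 e^3 < a^3. *)
  have : (2 * e) ^+ 3 < a ^+ 3.
    by rewrite ltrXn2r// ltW// mulr_gt0.
  have : 0 < e ^+ 3 by rewrite exprn_gt0.
  by rewrite exprMn; move: (e ^+ 3) (a ^+ 3) => ? ?; lra.
by field; rewrite a0 e0.
Qed.

End ThreePoints.

(** * The surface over the segment, near the fibre of the origin *)

Section NegativeOverOrigin.
Variables (R : realType) (m a e : R).
Hypotheses (hm : 0 <= m) (e_gt0 : 0 < e) (ltea : 2 * e < a).
Local Notation p := (three_points a e).
Variable X : gh_space m p.
Local Notation N := (surface_over X (point3 0 0 a) (point3 0 0 (- a))).

Let a_gt0 : 0 < a. Proof. by apply: lt_trans ltea; rewrite mulr_gt0. Qed.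

Lemma regular0 : regular_set p 0.
Proof.
have neq (s t r : R) j :
    point3 s t r 0 j != 0 -> (0 : 'rV[R]_3) != point3 s t r.
  by apply: contra => /eqP <-; rewrite mxE.
have a0 := lt0r_neq0 a_gt0; have e0 := lt0r_neq0 e_gt0.
case=> [[|[|[|]]]] //= ?; rewrite /three_points /=.
- by apply: (neq _ _ _ j2); rewrite mxE.
- by apply: (neq _ _ _ j2); rewrite mxE /= oppr_eq0.
- by apply: (neq _ _ _ j1); rewrite mxE.
Qed.

Lemma segment_axis (y : 'rV[R]_3) :
  line_segment (point3 0 0 a) (point3 0 0 (- a)) y -> y 0 j0 = 0 /\ y 0 j1 = 0.
Proof. by move=> [s _ <-]; rewrite !mxE /= !mulr0 addr0. Qed.

Lemma axis_segment (r : R) : `|r| < a ->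
  line_segment (point3 0 0 a) (point3 0 0 (- a)) (point3 0 0 r).
Proof.
rewrite ltr_norml => /andP[ra1 ra2]; have a0 := lt0r_neq0 a_gt0.
(* This is the solution s of (1 - s) a - s a = r. *)
exists ((a - r) / (2 * a)) => /=.
  have a2 : 0 < 2 * a by rewrite mulr_gt0.
  rewrite divr_ge0 ?(ltW a2) ?subr_ge0 ?(ltW ra2)//=.
  by rewrite ler_pdivrMr// mul1r; lra.
apply/rowP => j; rewrite !mxE; case: j => [[|[|[|]]]] //= _.
- by rewrite !mulr0 addr0.
- by rewrite !mulr0 addr0.
- by field.
Qed.

(** The parameters are the fibre coordinate and the height on the axis. The shift s moves the
    parameter value 0 to the prescribed point of the fibre, which differs from the zero of the
    trivialisation by a rotation through s. *)
Definition axis_param (s : R) (y : 'rV[R]_2) : 'rV[R]_4 :=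
  bundle_coord (y 0 ord0 + s) (point3 0 0 (y 0 ord_max)).

Lemma base_axis_param s y : base_pt (axis_param s y) = point3 0 0 (y 0 ord_max).
Proof. by apply/rowP => i; rewrite mxE [LHS]mxE liftK. Qed.

Lemma axis_paramE s y i : axis_param s y 0 i =
  if i == ord0 then y 0 ord0 + s
  else if i == lift ord0 j2 then y 0 ord_max else 0.
Proof.
rewrite mxE; case: (unliftP ord0 i) => [j ->|->]; last by rewrite eqxx.
rewrite -[lift ord0 j == ord0]/false mxE (inj_eq lift_inj).
by case: j => [[|[|[|]]]] //= ?.
Qed.

Lemma axis_param0 s : axis_param s 0 = s *: fibre_vec R.
Proof.
apply/rowP => i; rewrite axis_paramE !mxE eqxx /= add0r.
by case: (i == ord0); rewrite ?mulr1 ?mulr0 ?if_same.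
Qed.

Lemma smooth_axis_param (B : set 'rV[R]_2) s : smooth_vec_on B (axis_param s).
Proof.
move=> i; rewrite (_ : (fun y => _) = fun y : 'rV[R]_2 =>
   if i == ord0 then y 0 ord0 + s
   else if i == lift ord0 j2 then y 0 ord_max + 0 else 0).
  case: (i == ord0); first exact: smooth_on_coordD.
  case: (i == _); [exact: smooth_on_coordD|exact: smooth_on_cst].
by apply/funext => y; rewrite axis_paramE addr0.
Qed.

Lemma row_free_axis_param s y : row_free (jac (axis_param s) y).
Proof.
have jE a' i : jac (axis_param s) y a' i =
    pd a' (fun y => axis_param s y 0 i) y by rewrite !mxE.
apply: inj_row_free => v /rowP v0.
have pd0 b : pd b (fun y => axis_param s y 0 ord0) y = (b == ord0)%:R.
  rewrite (_ : (fun y => _) = fun y : 'rV[R]_2 => y 0 ord0 + s); last first.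
    by apply/funext => z; rewrite axis_paramE eqxx.
  rewrite pdD; [|exact: pdable_coord|exact: pdable_cst].
  by rewrite pd_coord pd_cst addr0.
have pd3 b : pd b (fun y => axis_param s y 0 (lift ord0 j2)) y =
    (b == ord_max)%:R.
  rewrite (_ : (fun y => _) = fun y : 'rV[R]_2 => y 0 ord_max) ?pd_coord//.
  by apply/funext => z; rewrite axis_paramE.
apply/rowP => i; rewrite [RHS]mxE.
have := v0 ord0; have := v0 (lift ord0 j2).
rewrite !mxE !big_ord_recl !big_ord0 !jE !pd0 !pd3 /=.
rewrite !(mulr0, mulr1, addr0, add0r) => v1 v00.
case: (unliftP ord0 i) => [j ->|->] //.
by rewrite (ord1 j).
Qed.

Lemma negative_over_origin (x : X) : gh_proj x = 0 -> negative_at N x.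
Proof.
move=> px0; split.
  (* Existence of a parametrisation: transitivity of the action on the fibre over the regular point
     0 provides the shift s. *)
  have [c Dc] := triv_cover X regular0.
  have Du : triv_dom c (base_pt 0).
    by rewrite (_ : base_pt 0 = 0)//; apply/rowP => i; rewrite !mxE.
  have [s xE] : exists s, x = gh_act s (triv_par c 0).
    have pu : gh_proj (triv_par c 0) = 0.
      by rewrite proj_triv//; apply/rowP => i; rewrite !mxE.
    by apply: act_trans; rewrite ?pu ?px0//; exact: regular0.
  exists c, (axis_param s), 0; split; last first.
    by rewrite xE act_triv// axis_param0 add0r.
  have cont1 : {for (0 : 'rV[R]_2),
      continuous (fun y : 'rV[R]_2 => y 0 ord_max)}.
    exact: coord_continuous.
  have contb : {for (0 : 'rV[R]_2),
      continuous (fun y : 'rV[R]_2 => base_pt (axis_param s y))}.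
    apply: continuous_rV => j; rewrite (_ : (fun y => _) = fun y : 'rV[R]_2 =>
      if j == j2 then y 0 ord_max else 0); last first.
      apply/funext => y; rewrite base_axis_param mxE.
      by case: j => [[|[|[|]]]].
    by case: (j == j2); [exact: coord_continuous|exact: cst_continuous].
  (* The height must stay in (-a, a) for the image to lie over the segment, and the base point must
     stay in the trivialisation. *)
  have near0 : nbhs (0 : 'rV[R]_2) [set y |
      triv_dom c (base_pt (axis_param s y)) /\ `|y 0 ord_max| < a].
    apply: filterI.
      apply: contb; apply: open_nbhs_nbhs; split; first exact: triv_open.
      rewrite axis_param0 (_ : base_pt _ = 0)//.
      by apply/rowP => i; rewrite !mxE mulr0.
    apply: (cont1 [set r | `|r| < a]); apply/nbhs_ballP; exists a => //= r.
    by rewrite /ball /= mxE sub0r normrN.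
  move: near0; rewrite nbhsE => -[B [oB B0] BP]; exists B; split=> //.
    exact: smooth_axis_param.
  move=> y /BP[Dy ya]; split=> //; last exact: row_free_axis_param.
  rewrite /surface_over /= proj_triv// base_axis_param.
  exact: axis_segment.
move=> c F w [[B [oB Bw sF BF]] xE].
have [Dw _ _] := BF w Bw.
have Fw0 : base_pt (F w) = 0 by rewrite -(proj_triv Dw) xE.
have D0 : triv_dom c 0 by rewrite -Fw0.
have oD : open (triv_dom c) by exact: triv_open.
have regD : triv_dom c `<=` regular_set p by exact: triv_regular.
apply: gh_axis_negative => //; rewrite ?Fw0.
(* Any parametrisation of N projects into the segment, so its first two base coordinates vanish near
   w. *)
- apply: (near_open oB Bw) => y By; have [Dy + _] := BF y By.
  rewrite /surface_over /= proj_triv// => /segment_axis.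
  by rewrite !mxE.
- exact: (pd1_three_points m oD regD D0).
- exact: (pd3_three_points m e_gt0 ltea oD regD D0).
- exact: (pd33_three_points m e_gt0 ltea oD regD D0).
Qed.

End NegativeOverOrigin.

Theorem proposition1p3 (R : realType) (m : R) (hm : 0 <= m) :
  (forall a : R, 0 < a ->
     exists e0 : R, 0 < e0 /\
     forall e : R, 0 < e -> e < e0 ->
     forall (X : gh_space m (three_points a e)) (x : X), gh_proj x = 0 ->
       negative_at (surface_over X (point3 0 0 a) (point3 0 0 (- a))) x) /\
  (forall e : R, 0 < e ->
     exists a0 : R, 0 < a0 /\
     forall a : R, a0 < a ->
     forall (X : gh_space m (three_points a e)) (x : X), gh_proj x = 0 ->
       negative_at (surface_over X (point3 0 0 a) (point3 0 0 (- a))) x).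
Proof.
split=> [a a0|e e0].
  (* Both thresholds, a / 2 here and 2 e below, restate the single condition 2 e < a. *)
  exists (a / 2); split=> [|e e0 ea X x]; first by rewrite divr_gt0.
  by apply: negative_over_origin => //; rewrite mulrC -ltr_pdivlMr.
exists (2 * e); split=> [|a ea X x]; first by rewrite mulr_gt0.
exact: negative_over_origin.
Qed.
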